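(* Let $\mu>0$ and $b\in L^\infty(\mathbb{T})$, and let $\boldsymbol{S}_1,\boldsymbol{S}_2$ be the operators of the water wave system $$\frac{\mathrm{d}}{\mathrm{d}t}\begin{pmatrix}\xi \\ v\end{pmatrix}=\boldsymbol{S}_1\begin{pmatrix}\xi \\ v\end{pmatrix}+\boldsymbol{S}_2\begin{pmatrix}\xi \\ v\end{pmatrix},\quad \boldsymbol{S}_1=\begin{pmatrix}0&\Omega \\ -\Omega&0\end{pmatrix},\quad\boldsymbol{S}_2=\begin{pmatrix}0&G\Omega^{-\frac12}\nabla\cdot\big(b(x)\,G\Omega^{-\frac12}\nabla\,\cdot\,\big) \\ 0&0\end{pmatrix},$$ where $\Omega^2=\frac{1}{\sqrt\mu}|D|\tanh(\sqrt\mu|D|)$ and $G=\mathrm{sech}(\sqrt\mu|D|)$. Then for all $s\geq0$ there exist $C_s>0$ and $\tau_0>0$ such that for all $x=(\xi,v)^T\in h^s\times h^s$ and $|\tau|\leq\tau_0$, $$\|e^{\tau\boldsymbol{S}_1}e^{\tau\boldsymbol{S}_2}x-e^{\tau(\boldsymbol{S}_1+\boldsymbol{S}_2)}x\|_s\leq C_s\tau^2\|x\|_s,$$ $$\|e^{\frac12\tau\boldsymbol{S}_1}e^{\tau\boldsymbol{S}_2}e^{\frac12\tau\boldsymbol{S}_1}x-e^{\tau(\boldsymbol{S}_1+\boldsymbol{S}_2)}x\|_s\leq C_s|\tau|^3\|x\|_s.$$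
   Context: $\mathbb{T}=\mathbb{R}/2\pi\mathbb{Z}$. Functions on $\mathbb{T}$ are identified with their sequences of Fourier coefficients $\hat u_k=\frac1{2\pi}\int_{\mathbb{T}}e^{-ikx}u(x)\,\mathrm{d}x$, $k\in\mathbb{Z}$. For $s\in\mathbb{R}$, $h^s$ is the space of sequences with $\|u\|_s=\big(\sum_{k\in\mathbb{Z}}(1+|k|)^{2s}|\hat u_k|^2\big)^{1/2}<\infty$, and $\|\cdot\|_s$ on $h^s\times h^s$ is the product norm. $\nabla=\partial_x$ and $|D|=|-i\nabla|$ is the Fourier multiplier by $|k|$. $\Omega\geq0$ is the Fourier multiplier by $\Omega_k=\big(\frac{1}{\sqrt\mu}|k|\tanh(\sqrt\mu|k|)\big)^{1/2}$, and $G$ the Fourier multiplier by $G_k=\mathrm{sech}(\sqrt\mu|k|)$. The upper right entry of $\boldsymbol{S}_2$ is the operator with Fourier matrix $$A(n,m)=G_n\Omega_n^{-\frac12}(in)\,\hat b_{n-m}\,(im)\,G_m\Omega_m^{-\frac12},\quad n,m\in\mathbb{Z},$$ where $k\,\Omega_k^{-1/2}$ is understood as $0$ for $k=0$. For $\boldsymbol{S}\in\{\boldsymbol{S}_1,\boldsymbol{S}_2,\boldsymbol{S}_1+\boldsymbol{S}_2\}$, $e^{t\boldsymbol{S}}$ denotes the flow of $\dot x=\boldsymbol{S}x$ on $h^s\times h^s$. *)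

(* Defs.v *)
From HB Require Import structures.
From mathcomp Require Import all_boot all_order all_algebra.
From mathcomp Require Export complex.
From mathcomp Require Import all_classical all_reals all_analysis.

Set Implicit Arguments.
Unset Strict Implicit.
Unset Printing Implicit Defensive.

Import Order.TTheory GRing.Theory Num.Theory.
Import numFieldNormedType.Exports.

Local Open Scope classical_set_scope.
Local Open Scope ring_scope.
Local Open Scope complex_scope.

Section Fourier.
Context {R : realType}.

(* Functions on the torus R / 2 pi Z are 2pi-periodic functions on R.  By
   periodicity, the essential supremum over R is the one over the torus. *)
Definition Linfty_torus (b : R -> R[i]) : Prop :=
  [/\ forall x, b (x + 2 * pi) = b x,
      (fun x => complex.Re (b x)) \in Lfun (@lebesgue_measure R) +oo%E
    & (fun x => complex.Im (b x)) \in Lfun (@lebesgue_measure R) +oo%E].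

Definition cintegral (D : set R) (f : R -> R[i]) : R[i] :=
  (\int[@lebesgue_measure R]_(x in D) complex.Re (f x)) +i*
  (\int[@lebesgue_measure R]_(x in D) complex.Im (f x)).

Definition expi (t : R) : R[i] := cos t +i* sin t.

Definition fourier (u : R -> R[i]) (k : int) : R[i] :=
  ((2 * pi)^-1)%:C *
  cintegral `[0, 2 * pi] (fun x => expi (- (k%:~R * x)) * u x).

(* The sum over k in Z, as the limit of the sums over -N <= k <= N. *)
Definition zsum (f : int -> R[i]) : R[i] :=
  let S N := \sum_(0 <= j < N.*2.+1) f (j%:Z - N%:Z) in
  limn (fun N => complex.Re (S N)) +i* limn (fun N => complex.Im (S N)).

(* A pair (xi, v) of sequences of Fourier coefficients. *)
Definition state : Type := ((int -> R[i]) * (int -> R[i]))%type.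

(* Equal to +oo outside h^s. *)
Definition hnorm (s : R) (u : int -> R[i]) : \bar R :=
  sqrte (\esum_(k in [set: int])
           ((1 + `|k%:~R|) `^ (2 * s) * Normc.normc (u k) ^+ 2)%:E)%E.

Definition norm_hs (s : R) (x : state) : \bar R :=
  sqrte (hnorm s x.1 ^+ 2 + hnorm s x.2 ^+ 2)%E.

Definition hs (s : R) : set state := [set x | (norm_hs s x < +oo)%E].

(* The trajectories of x' = S x in h^s x h^s: continuous curves in this space
   that satisfy the equation on each Fourier coefficient.  S may be unbounded
   on h^s x h^s, so that the derivative need not exist in the norm of this
   space. *)
Definition is_trajectory (s : R) (S : state -> state) (X : R -> state) : Prop :=
  [/\ forall t, hs s (X t),
      forall t, norm_hs s (X r - X t) @[r --> t] --> 0%E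
    & forall (t : R) (k : int),
      [/\ is_derive t 1 (fun r => complex.Re ((X r).1 k))
            (complex.Re ((S (X t)).1 k)),
          is_derive t 1 (fun r => complex.Im ((X r).1 k))
            (complex.Im ((S (X t)).1 k)),
          is_derive t 1 (fun r => complex.Re ((X r).2 k))
            (complex.Re ((S (X t)).2 k))
        & is_derive t 1 (fun r => complex.Im ((X r).2 k))
            (complex.Im ((S (X t)).2 k))]].

(* e^{tS} x, the value at time t of the trajectory in h^s x h^s that starts at
   x; the default 0 only occurs if there is no such trajectory. *)
Definition flow (s : R) (S : state -> state) (t : R) (x : state) : state :=
  xget 0 [set y | exists X, [/\ is_trajectory s S X, X 0 = x & X t = y]].

End Fourier.

Arguments state : clear implicits.

Section WaterWaves.
Context {R : realType}.

Definition tanh (x : R) : R := (expR x - expR (- x)) / (expR x + expR (- x)).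
Definition sech (x : R) : R := 2 / (expR x + expR (- x)).

Definition multiplier (a : int -> R) (u : int -> R[i]) : int -> R[i] :=
  fun k => (a k)%:C * u k.

Definition Omega (mu : R) (k : int) : R :=
  Num.sqrt ((Num.sqrt mu)^-1 * `|k%:~R| * tanh (Num.sqrt mu * `|k%:~R|)).

Definition G (mu : R) (k : int) : R := sech (Num.sqrt mu * `|k%:~R|).

(* The factor i n (resp. i m) makes this 0 for n = 0 (resp. m = 0), where
   Omega mu 0 = 0. *)
Definition A (mu : R) (b : R -> R[i]) (n m : int) : R[i] :=
  (G mu n * Omega mu n `^ (- 2^-1))%:C * ('i * n%:~R) * fourier b (n - m) *
  ('i * m%:~R) * (G mu m * Omega mu m `^ (- 2^-1))%:C.

Definition S1 (mu : R) (x : state R) : state R :=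
  (multiplier (Omega mu) x.2, - multiplier (Omega mu) x.1).

Definition S2 (mu : R) (b : R -> R[i]) (x : state R) : state R :=
  (fun n => zsum (fun m => A mu b n m * x.2 m), 0).

End WaterWaves.

(* Main.v *)
Require Import Defs.
From HB Require Import structures.
From mathcomp Require Import all_boot all_order all_algebra.
From mathcomp Require Import all_classical all_reals all_analysis.
From mathcomp Require Import ess_sup_inf measurable_realfun.
From mathcomp Require Import ring lra zify.
Import Order.TTheory GRing.Theory Num.Theory.
Import numFieldNormedType.Exports.
Local Open Scope classical_set_scope.
Local Open Scope ring_scope.
Local Open Scope complex_scope.

Set Implicit Arguments.
Unset Strict Implicit.
Unset Printing Implicit Defensive.

(** The operators [S1] and [S2] play very different roles.  [S1] rotates the
    two components of mode [k] with frequency [Omega_k], of order [sqrt |k|]: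
    it is unbounded, but its group is an explicit isometry.  [S2] is
    smoothing: the factor [sech] makes its matrix entries smaller than
    [a_n a_m] for a profile [a] of exponential decay, because the Fourier
    coefficients of [b] are bounded.  Moreover [S2 S2 = 0], so that
    [exp (t S2) = 1 + t S2].

    Let [X] be the trajectory of [S1 + S2] from [x] and
    [Y t = exp (- t S1) (X t)].  In this rotating frame
    [Y' t = B t (Y t)] with [B t = exp (- t S1) S2 exp (t S1)], and since the
    group of [S1] is isometric the two local errors are the norms of
    [x + t (B 0) x - Y t] (Lie) and [x + t (B (t / 2)) x - Y t] (Strang).
    As [(B 0) (B 0) = S2 S2 = 0], the Taylor expansion of [Y] is
    [x + t (B 0) x + t^2 / 2 (B' 0) x + O (t^3)], which the Lie method matches
    to first order and the Strang method to second order.  Each derivative of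
    [B] costs a factor [Omega_k], which the profile [a] absorbs.  Therefore
    all expansions are carried out mode by mode, with scalar mean value
    inequalities, and their remainders are bounded by [a_k exp (2 Omega_k)]
    times the size of [x] (rotating_frame_expansion, force_expansion,
    modulated_expansion); only the last step sums over [k]
    (norm_hs_profile).

    The flows are defined through trajectories, so these must be shown to
    exist for all times.  The iterates [(S1 + S2)^j x] have modes of size at
    most [C j! T^(- j) 2^(- j) exp (sigma Omega_k)] for every [T], by an
    argument of Cauchy-Kovalevskaya type in the scale of weights
    [exp (sigma Omega_k)] (iterates_scale, iterates_entire).  Hence every mode
    of the solution is the sum of an everywhere convergent exponential series
    (coupled_solution).  Its continuity in [h^s] is read off in the rotating
    frame, where the solution differs from the initial datum by a multiple of
    the profile (driven_continuous).  The flow is the value of an unspecified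
    trajectory; the a priori bound behind the expansions holds for all of them
    (trajectory_apriori). *)

(** * The modulus of complex numbers *)

Notation normc := Normc.normc.

Lemma le_of_eq (R : realType) (x y : R) : x = y -> x <= y.
Proof. by move=> ->. Qed.

Section ComplexModulus.
Context {R : realType}.
Implicit Types (x : R) (z w : R[i]).

Lemma normc_ge0 z : 0 <= normc z.
Proof. by case: z => a b; exact: sqrtr_ge0. Qed.

Lemma sqr_normcE z : normc z ^+ 2 = complex.Re z ^+ 2 + complex.Im z ^+ 2.
Proof. by case: z => a b /=; rewrite sqr_sqrtr// addr_ge0// sqr_ge0. Qed.

Lemma normcD z w : normc (z + w) <= normc z + normc w.
Proof. exact: le_normcD. Qed.

Lemma normcB z w : normc (z - w) <= normc z + normc w.
Proof. by rewrite -(normcN w) normcD. Qed.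

Lemma normcR x : normc x%:C = `|x|.
Proof. by rewrite /= expr0n /= addr0 sqrtr_sqr. Qed.

Lemma normc_int (k : int) : normc (k%:~R : R[i]) = `|k%:~R|.
Proof. by rewrite -normcR; congr normc; rewrite rmorph_int. Qed.

Lemma normcZ x z : normc (x%:C * z) = `|x| * normc z.
Proof. by rewrite Normc.normcM normcR. Qed.

Lemma ler_Re_normc z : `|complex.Re z| <= normc z.
Proof.
by rewrite -(ler_sqr (x := `|_|)) ?nnegrE ?normc_ge0// sqr_normcE real_normK
  ?num_real// lerDl sqr_ge0.
Qed.

Lemma ler_Im_normc z : `|complex.Im z| <= normc z.
Proof.
by rewrite -(ler_sqr (x := `|_|)) ?nnegrE ?normc_ge0// sqr_normcE real_normK
  ?num_real// lerDr sqr_ge0.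
Qed.

Lemma normc_le_ReIm z : normc z <= `|complex.Re z| + `|complex.Im z|.
Proof.
rewrite -ler_sqr ?nnegrE ?normc_ge0 ?addr_ge0// sqr_normcE sqrrD.
by rewrite !real_normK ?num_real// -addrA lerD2l lerDr mulrn_wge0// mulr_ge0.
Qed.

Lemma ReD z w : complex.Re (z + w) = complex.Re z + complex.Re w.
Proof. by case: z w => [a b] [c d]. Qed.

Lemma ImD z w : complex.Im (z + w) = complex.Im z + complex.Im w.
Proof. by case: z w => [a b] [c d]. Qed.

Lemma ReN z : complex.Re (- z) = - complex.Re z.
Proof. by case: z. Qed.

Lemma ImN z : complex.Im (- z) = - complex.Im z.
Proof. by case: z. Qed.

Lemma ReZ x z : complex.Re (x%:C * z) = x * complex.Re z.
Proof. by case: z => a b /=; rewrite mul0r subr0. Qed.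

Lemma ImZ x z : complex.Im (x%:C * z) = x * complex.Im z.
Proof. by case: z => a b /=; rewrite mul0r addr0. Qed.

Lemma Re_sum (I : Type) (r : seq I) (F : I -> R[i]) :
  complex.Re (\sum_(i <- r) F i) = \sum_(i <- r) complex.Re (F i).
Proof. by elim/big_ind2: _ => // z1 x1 z2 x2 <- <-; rewrite ReD. Qed.

Lemma Im_sum (I : Type) (r : seq I) (F : I -> R[i]) :
  complex.Im (\sum_(i <- r) F i) = \sum_(i <- r) complex.Im (F i).
Proof. by elim/big_ind2: _ => // z1 x1 z2 x2 <- <-; rewrite ImD. Qed.

Lemma complex_ext z w :
  complex.Re z = complex.Re w -> complex.Im z = complex.Im w -> z = w.
Proof. by case: z w => [a b] [c d] /= -> ->. Qed.

End ComplexModulus.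

(** * Two-sided series *)

(** Locked, since simplification would expose the first element of the
    sequence and hide its membership criterion. *)
HB.lock Definition window (N : nat) : seq int :=
  [seq j%:Z - N%:Z | j <- iota 0 N.*2.+1].

Section Windows.

Lemma mem_window N k : (k \in window N) = (`|k| <= N)%N.
Proof.
rewrite window.unlock; apply/mapP/idP => [[j]|kN].
  by rewrite mem_iota => jN ->; lia.
by exists (absz (k + N%:Z)); [rewrite mem_iota; lia|lia].
Qed.

Lemma window_uniq N : uniq (window N).
Proof. by rewrite window.unlock map_inj_uniq ?iota_uniq// => i j; lia. Qed.

Lemma big_windowS (V : nmodType) (F : int -> V) N :
  \sum_(k <- window N.+1) F k =
  F N.+1%:Z + (F (- N.+1%:Z) + \sum_(k <- window N) F k).
Proof.
transitivity (\sum_(k <- [:: N.+1%:Z, - N.+1%:Z & window N]) F k); last first.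
  by rewrite 2!big_cons.
apply: perm_big; apply: uniq_perm.
- exact: window_uniq.
- rewrite 2!cons_uniq in_cons !mem_window window_uniq andbT.
  by apply/andP; split; lia.
- by move=> k; rewrite mem_window 2!in_cons mem_window; lia.
Qed.

Context {R : realType}.
Implicit Types f : int -> R.

Lemma ler_sum_uniq (s s' : seq int) f : (forall k, 0 <= f k) ->
  uniq s -> uniq s' -> {subset s <= s'} ->
  \sum_(k <- s) f k <= \sum_(k <- s') f k.
Proof.
move=> f0 us us' ss'; rewrite [leRHS](bigID (mem s))/=.
have -> : \sum_(k <- s' | k \in s) f k = \sum_(k <- s) f k.
  rewrite -big_filter; apply: perm_big; apply: uniq_perm => //.
    exact: filter_uniq.
  by move=> k; rewrite mem_filter; case: (boolP (k \in s)) => // /ss' ->.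
by rewrite lerDl sumr_ge0.
Qed.

(** One window nearly attains the supremum of the window sums; what lies
    outside it, in any window, is then small. *)
Lemma window_tail f L : (forall k, 0 <= f k) ->
    (forall N, \sum_(k <- window N) f k <= L) ->
  forall e, 0 < e -> exists N0, forall N,
    \sum_(k <- window N | (N0 < `|k|)%N) f k <= e.
Proof.
move=> f0 fL e e0; pose S := [set \sum_(k <- window N) f k | N in [set: nat]].
have S_sup : has_sup S.
  split; first by exists (\sum_(k <- window 0) f k), 0%N.
  by exists L => _ [N _ <-].
have [_ [N0 _ <-] N0e] := sup_adherent e0 S_sup.
exists N0 => N; rewrite -(lerD2r (\sum_(k <- window N0) f k)).
rewrite -[X in X + _]big_filter.
rewrite -big_cat/=; apply: (@le_trans _ _ (sup S)); last first.
  by rewrite -lerBlDl ltW.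
apply: le_trans (_ : \sum_(k <- window (maxn N N0)) f k <= _); last first.
  by apply: ub_le_sup; [exact: S_sup.2|exists (maxn N N0)].
apply: ler_sum_uniq => //; last 2 first.
- exact: window_uniq.
- by move=> k; rewrite mem_cat mem_filter !mem_window; lia.
rewrite cat_uniq filter_uniq ?window_uniq// andbT andTb.
apply/hasPn => k ; rewrite /= mem_filter !mem_window; lia.
Qed.

(** A universal summable sequence, to which every decaying sequence is
    compared. *)
Definition invsq (k : int) : R := ((1 + `|k%:~R|) ^+ 2)^-1.

Lemma invsq_gt0 k : 0 < invsq k.
Proof. by rewrite invr_gt0 exprn_gt0// ltr_wpDr. Qed.

Lemma invsq_le1 k : invsq k <= 1.
Proof. by rewrite invf_le1 ?exprn_gt0 ?ltr_wpDr// exprn_ege1// lerDl. Qed.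

Lemma sum_invsq N : \sum_(k <- window N) invsq k <= 3.
Proof.
suff : \sum_(k <- window N) invsq k <= 3 - 2 / N.+1%:R.
  by move=> /le_trans; apply; rewrite gerBl.
elim: N => [|N IH].
  by rewrite window.unlock big_seq1 /invsq subrr normr0 addr0 expr1n invr1; lra.
rewrite big_windowS; set S := \sum_(_ <- _) _ in IH *.
have -> : invsq (- N.+1%:Z) = invsq N.+1 by rewrite /invsq rmorphN normrN.
rewrite /invsq -pmulrn ger0_norm// -(natr1 N.+1) -(natr1 N) in IH *.
set n : R := N%:R in IH *; have n0 : 0 <= n by exact: ler0n.
have -> : 2 / (n + 1 + 1) = 2 / (n + 1) - 2 / ((n + 1) * (n + 2)).
  by field; rewrite !gt_eqF ?ltr_wpDl.
suff : ((1 + (n + 1)) ^+ 2)^-1 <= ((n + 1) * (n + 2))^-1 by lra.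
by rewrite lef_pV2 ?posrE ?exprn_gt0 ?mulr_gt0 ?ltr_wpDl ?ltr_wpDr//; nra.
Qed.

End Windows.

Section TwoSidedSeries.
Context {R : realType}.
Implicit Types (F G : int -> R[i]) (f g : int -> R).

Definition abs_summable F :=
  exists L, forall N, \sum_(k <- window N) normc (F k) <= L.

Lemma abs_summable_le F f L : (forall k, normc (F k) <= f k) ->
  (forall N, \sum_(k <- window N) f k <= L) -> abs_summable F.
Proof.
by move=> Ff fL; exists L => N; apply: le_trans (fL N); exact: ler_sum.
Qed.

Let zlim f : R := limn (fun N => \sum_(k <- window N) f k).

(** The monotone sums of [f + g] and of [g] converge, hence so does their
    difference. *)
Lemma window_cvg f g L : (forall k, `|f k| <= g k) ->
    (forall N, \sum_(k <- window N) g k <= L) ->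
  cvgn (fun N => \sum_(k <- window N) f k).
Proof.
move=> fg gL; have g0 k : 0 <= g k by exact: le_trans (fg k).
have mono h : (forall k, 0 <= h k) -> (forall k, h k <= 2 * g k) ->
    cvgn (fun N => \sum_(k <- window N) h k).
  move=> h0 hg; apply: nondecreasing_is_cvgn.
    move=> m n mn; apply: ler_sum_uniq; rewrite ?window_uniq// => k.
    by rewrite !mem_window => /leq_trans; apply.
  exists (2 * L) => _ [N _ <-]; apply: le_trans (_ : 2 * _ <= _); last first.
    by rewrite ler_pM2l//; exact: gL.
  by rewrite mulr_sumr; exact: ler_sum.
rewrite (_ : (fun N => _) = (fun N => \sum_(k <- window N) (f k + g k)) -
    (fun N => \sum_(k <- window N) g k)).
  apply: is_cvgB; apply: mono => k.
  - by have := fg k; rewrite ler_norml => /andP[]; lra.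
  - by have := fg k; rewrite ler_norml => /andP[]; lra.
  - by [].
  - by have := g0 k; lra.
by apply/funext => N; rewrite !fctE big_split/= addrK.
Qed.

Lemma zsumE F : zsum F =
  zlim (fun k => complex.Re (F k)) +i* zlim (fun k => complex.Im (F k)).
Proof.
rewrite /zsum /zlim; congr (limn _ +i* limn _); apply/funext => N.
  by rewrite -Re_sum window.unlock big_map /index_iota subn0.
by rewrite -Im_sum window.unlock big_map /index_iota subn0.
Qed.

Lemma abs_summable_Re F : abs_summable F ->
  cvgn (fun N => \sum_(k <- window N) complex.Re (F k)).
Proof. by move=> [L FL]; apply: window_cvg FL => k; exact: ler_Re_normc. Qed.

Lemma abs_summable_Im F : abs_summable F ->
  cvgn (fun N => \sum_(k <- window N) complex.Im (F k)).
Proof. by move=> [L FL]; apply: window_cvg FL => k; exact: ler_Im_normc. Qed.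

Let zlim_linear f g (c : R) :
  cvgn (fun N => \sum_(k <- window N) f k) ->
  cvgn (fun N => \sum_(k <- window N) g k) ->
  zlim (fun k => f k + c * g k) = zlim f + c * zlim g.
Proof.
move=> cf cg; apply: cvg_lim => //.
under eq_fun do rewrite big_split/= -mulr_sumr.
by apply: cvgD cf _; apply: cvgMr.
Qed.

Lemma zsum_linear F G (c : R) : abs_summable F -> abs_summable G ->
  zsum (fun k => F k + c%:C * G k) = zsum F + c%:C * zsum G.
Proof.
move=> sF sG; rewrite !zsumE; apply: complex_ext; rewrite ?ReD ?ImD ?ReZ ?ImZ/=.
  rewrite -zlim_linear; [|exact: abs_summable_Re..].
  by congr zlim; apply/funext => k; rewrite ReD ReZ.
rewrite -zlim_linear; [|exact: abs_summable_Im..].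
by congr zlim; apply/funext => k; rewrite ImD ImZ.
Qed.

Lemma normc_zsum_le F f L : (forall k, normc (F k) <= f k) ->
  (forall N, \sum_(k <- window N) f k <= L) -> normc (zsum F) <= 2 * L.
Proof.
move=> Ff fL; have sF := abs_summable_le Ff fL.
have lim_le h : (forall k, `|h k| <= f k) ->
    cvgn (fun N => \sum_(k <- window N) h k) -> `|zlim h| <= L.
  move=> hf ch; rewrite ler_norml; apply/andP; split.
    apply: limr_ge => //; apply: nearW => N; rewrite lerNl -sumrN.
    apply: le_trans (fL N); apply: ler_sum => k _.
    by apply: le_trans (hf k); rewrite -normrN ler_norm.
  apply: limr_le => //; apply: nearW => N.
  by apply: le_trans (fL N); apply: ler_sum => k _; exact: le_trans (ler_norm _) (hf k).
apply: le_trans (normc_le_ReIm _) _; rewrite zsumE mulr2n mulrDl mul1r.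
apply: lerD; apply: lim_le => [k|].
- exact: le_trans (ler_Re_normc _) _.
- exact: abs_summable_Re.
- exact: le_trans (ler_Im_normc _) _.
- exact: abs_summable_Im.
Qed.

Lemma zsum0 : zsum (fun _ : int => 0 : R[i]) = 0.
Proof.
rewrite zsumE /zlim; apply: complex_ext => /=;
  by apply: lim_near_cst => //; apply: nearW => N; rewrite big1.
Qed.

Lemma zsumZ F (c : R) : abs_summable (fun k => c%:C * F k) ->
  zsum (fun k => c%:C * F k) = c%:C * zsum F.
Proof.
have [->|c0] := eqVneq c 0.
  by rewrite mul0r -[RHS]zsum0 => _; congr zsum; apply/funext => k; rewrite mul0r.
move=> [L cFL]; have sF : abs_summable F.
  exists (`|c|^-1 * L) => N.
  rewrite -ler_pdivrMl ?invr_gt0 ?normr_gt0// invrK mulr_sumr.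
  by apply: le_trans (cFL N); apply: ler_sum => k _; rewrite normcZ.
have s0 : abs_summable (fun _ : int => 0 : R[i]).
  by exists 0 => N; rewrite big1// => k _; exact: Normc.normc0.
rewrite -[RHS]add0r -[in RHS]zsum0 -zsum_linear//.
by congr zsum; apply/funext => k; rewrite add0r.
Qed.

End TwoSidedSeries.

(** * The norm through finite sums *)

Section SobolevEnergy.
Context {R : realType}.
Implicit Types (s : R) (x : state R).

Lemma esum_window_le (f : int -> R) L : (forall k, 0 <= f k) ->
  (forall N, \sum_(k <- window N) f k <= L) ->
  (\esum_(k in [set: int]) (f k)%:E <= L%:E)%E.
Proof.
move=> f0 fL; apply: ge_ereal_sup => _ /= [F [finF _] <-].
rewrite fsbig_finite// sumEFin lee_fin.
apply: le_trans (fL (\max_(k <- finmap.enum_fset (fset_set F)) absz k)%N).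
apply: ler_sum_uniq; rewrite ?window_uniq ?finmap.fset_uniq// => k kF.
by rewrite mem_window; apply: (@leq_bigmax_seq _ _ _ _ k).
Qed.

Lemma window_le_esum (f : int -> R) N : (forall k, 0 <= f k) ->
  ((\sum_(k <- window N) f k)%:E <= \esum_(k in [set: int]) (f k)%:E)%E.
Proof.
move=> f0; apply: esum_ge; exists [set` window N].
  by split=> //; exact: finite_seq.
by rewrite -fsbig_seq ?window_uniq// sumEFin.
Qed.

Definition weight s (k : int) : R := (1 + `|k%:~R|) `^ s.

Lemma weight_gt0 s k : 0 < weight s k.
Proof. by rewrite powR_gt0// ltr_wpDr. Qed.

Lemma weight_ge1 s k : 0 <= s -> 1 <= weight s k.
Proof. by move=> s0; rewrite -(powRr0 (1 + `|k%:~R|)) ler_powR// lerDl. Qed.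

(** The square of the norm of [h^s x h^s], truncated to the modes
    [|k| <= N]: all estimates of the norm are estimates of these finite
    sums. *)
Definition energy s x N : R := \sum_(k <- window N)
  weight s k ^+ 2 * (normc (x.1 k) ^+ 2 + normc (x.2 k) ^+ 2).

Let density_ge0 s x k :
  0 <= weight s k ^+ 2 * (normc (x.1 k) ^+ 2 + normc (x.2 k) ^+ 2).
Proof. by rewrite mulr_ge0 ?sqr_ge0// addr_ge0 ?sqr_ge0. Qed.

Lemma energy_ge0 s x N : 0 <= energy s x N.
Proof. by apply: sumr_ge0 => k _; exact: density_ge0. Qed.

Lemma norm_hsE s x : norm_hs s x = sqrte (\esum_(k in [set: int])
  (weight s k ^+ 2 * (normc (x.1 k) ^+ 2 + normc (x.2 k) ^+ 2))%:E).
Proof.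
have h0 (u : int -> R[i]) k :
    (0 <= ((1 + `|k%:~R|) `^ (2 * s) * normc (u k) ^+ 2)%:E)%E.
  by rewrite lee_fin mulr_ge0 ?powR_ge0 ?sqr_ge0.
rewrite /norm_hs /hnorm !sqr_sqrte; [|by apply: esum_ge0 => k _; exact: h0..].
rewrite -esumD => [|k _|k _]; [|exact: h0..].
congr sqrte; apply: eq_esum => k _.
by rewrite -EFinD -mulrDr /weight [2 * s]mulrC powRrM powR_mulrn ?powR_ge0.
Qed.

Lemma norm_hs_ge0 s x : (0 <= norm_hs s x)%E.
Proof. exact: sqrte_ge0. Qed.

Lemma norm_hs_leP s x c : 0 <= c ->
  (norm_hs s x <= c%:E)%E <-> (forall N, energy s x N <= c ^+ 2).
Proof.
move=> c0; have -> : c%:E = sqrte (c ^+ 2)%:E.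
  by rewrite /= sqrtr_sqr ger0_norm.
rewrite norm_hsE lee_sqrt ?lee_fin ?sqr_ge0//; split=> [h N|h].
  by rewrite -lee_fin; apply: le_trans h; exact: window_le_esum.
by apply: esum_window_le => // k; exact: density_ge0.
Qed.

Lemma hs_normP s x : hs s x -> exists n : R, [/\ 0 <= n,
  norm_hs s x = n%:E & forall N, energy s x N <= n ^+ 2].
Proof.
move=> hx; have fx : norm_hs s x \is a fin_num by rewrite ge0_fin_numE ?norm_hs_ge0.
exists (fine (norm_hs s x)); rewrite fineK//; split=> //.
  by rewrite fine_ge0// norm_hs_ge0.
by apply/norm_hs_leP; rewrite ?fineK// fine_ge0// norm_hs_ge0.
Qed.

Lemma hs_energy s x L : (forall N, energy s x N <= L) -> hs s x.
Proof.
move=> xL; have L0 : 0 <= L by exact: le_trans (energy_ge0 s x 0) (xL 0%N).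
apply: (@le_lt_trans _ _ (Num.sqrt L)%:E); last exact: ltry.
by apply/norm_hs_leP => //; rewrite sqr_sqrtr.
Qed.

Lemma energy_coord s x n : 0 <= s -> 0 <= n ->
    (forall N, energy s x N <= n ^+ 2) ->
  forall k, normc (x.1 k) <= n /\ normc (x.2 k) <= n.
Proof.
move=> s0 n0 xn k.
have : normc (x.1 k) ^+ 2 + normc (x.2 k) ^+ 2 <= n ^+ 2.
  apply: le_trans (xn `|k|%N).
  apply: le_trans (_ : \sum_(i <- [:: k])
    weight s i ^+ 2 * (normc (x.1 i) ^+ 2 + normc (x.2 i) ^+ 2) <= _).
    by rewrite big_seq1 ler_peMl ?addr_ge0 ?sqr_ge0// exprn_ege1// weight_ge1.
  apply: ler_sum_uniq; rewrite ?window_uniq// => i.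
  by rewrite mem_seq1 mem_window => /eqP ->.
have q0 := normc_ge0 (x.2 k).
have p0 := normc_ge0 (x.1 k); have := sqr_ge0 (normc (x.1 k)).
have := sqr_ge0 (normc (x.2 k)) => h1 h2 h3.
by split; rewrite -ler_sqr ?nnegrE//; lra.
Qed.

End SobolevEnergy.

(** * Mean value inequalities *)

Section MeanValue.
Context {R : realType}.
Implicit Types (f df : R -> R) (F dF : R -> R[i]) (K t : R).

Lemma is_derive_within f df (a b : R) : (forall t : R, is_derive t 1 f (df t)) ->
  {within `[a, b], continuous f}.
Proof.
move=> fd; apply: continuous_subspaceT => t.
by apply: differentiable_continuous; apply/derivable1_diffP; case: (fd t).
Qed.

Lemma mean_value_le f df K t : (forall r : R, is_derive r 1 f (df r)) ->
  (forall r, `|r| <= `|t| -> `|df r| <= K) -> `|f t - f 0| <= K * `|t|.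
Proof.
move=> fd dfK; have [t0|t0] := leP 0 t.
  have [c /[!in_itv]/= /andP[c0 ct] ->] :=
    MVT_segment t0 (fun r _ => fd r) (is_derive_within (a := 0) (b := t) fd).
  rewrite subr0 normrM ler_wpM2r//; apply: dfK.
  by rewrite !ger0_norm// (le_trans c0 ct).
have [c /[!in_itv]/= /andP[tc c0]] :=
  MVT_segment (ltW t0) (fun r _ => fd r) (is_derive_within (a := t) (b := 0) fd).
move=> e; rewrite -normrN opprB e sub0r normrM normrN ler_wpM2r//; apply: dfK.
by rewrite !ler0_norm ?lerN2// ltW.
Qed.

(** The real and imaginary parts are differentiated separately because this
    is how trajectories are defined. *)
Definition cderive F (dF : R[i]) (t : R) :=
  is_derive t 1 (fun r => complex.Re (F r)) (complex.Re dF) /\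
  is_derive t 1 (fun r => complex.Im (F r)) (complex.Im dF).

(** Mean value inequality for [F t - t P - t^2 / 2 Q]; the factor [2] comes
    from the separate treatment of the real and imaginary parts. *)
Lemma cderive_taylor2 F dF (P Q : R[i]) K t : (forall r, cderive F (dF r) r) ->
  (forall r, `|r| <= `|t| -> normc (dF r - P - r%:C * Q) <= K) ->
  normc (F t - F 0 - t%:C * P - (t ^+ 2 / 2)%:C * Q) <= 2 * K * `|t|.
Proof.
move=> Fd dFK; apply: le_trans (normc_le_ReIm _) _.
have -> : 2 * K * `|t| = K * `|t| + K * `|t| by ring.
have real (f df : R -> R) p q : (forall r : R, is_derive r 1 f (df r)) ->
    (forall r, `|r| <= `|t| -> `|df r - p - r * q| <= K) ->
    `|f t - f 0 - t * p - t ^+ 2 / 2 * q| <= K * `|t|.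
  move=> fd fK; pose g r := f r - (r * p + r ^+ 2 * (q / 2)).
  have gd (r : R) : is_derive r 1 g (df r - p - r * q).
    have fdr := fd r; apply: is_derive_eq.
    by rewrite /GRing.scale/=; field.
  have -> : f t - f 0 - t * p - t ^+ 2 / 2 * q = g t - g 0.
    by rewrite /g; field.
  exact: mean_value_le gd fK.
apply: lerD.
- rewrite !(ReD, ReN, ReZ).
  apply: (real (fun r => complex.Re (F r)) (fun r => complex.Re (dF r))).
    by move=> r; exact: (Fd r).1.
  move=> r /dFK; apply: le_trans; apply: le_trans (ler_Re_normc _).
  by rewrite !(ReD, ReN, ReZ).
- rewrite !(ImD, ImN, ImZ).
  apply: (real (fun r => complex.Im (F r)) (fun r => complex.Im (dF r))).
    by move=> r; exact: (Fd r).2.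
  move=> r /dFK; apply: le_trans; apply: le_trans (ler_Im_normc _).
  by rewrite !(ImD, ImN, ImZ).
Qed.

Lemma cderive_lipschitz F dF K t : (forall r, cderive F (dF r) r) ->
  (forall r, `|r| <= `|t| -> normc (dF r) <= K) ->
  normc (F t - F 0) <= 2 * K * `|t|.
Proof.
move=> Fd dFK; have := @cderive_taylor2 F dF 0 0 K t Fd.
by rewrite !mulr0 !subr0; apply => r rt; rewrite mulr0 !subr0; exact: dFK.
Qed.

Lemma cderive_affine F (P : R[i]) t : (forall r, cderive F P r) ->
  F t = F 0 + t%:C * P.
Proof.
move=> FP; apply/eqP; rewrite -subr_eq0; apply/eqP/Normc.eq0_normc.
apply/eqP; rewrite eq_le normc_ge0 andbT.
have := @cderive_taylor2 _ _ P 0 0 t FP.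
rewrite mulr0 subr0 mulr0 mul0r opprD addrA; apply => r _.
by rewrite mulr0 subr0 subrr Normc.normc0.
Qed.

Lemma cderive_cont F (dF : R[i]) t : cderive F dF t ->
  forall e, 0 < e -> \forall r \near t, normc (F r - F t) <= e.
Proof.
move=> [[Fr _] [Fi _]] e e0; have e2 : 0 < e / 2 by lra.
have /differentiable_continuous cr : differentiable (fun r => complex.Re (F r)) t.
  exact/derivable1_diffP.
have /differentiable_continuous ci : differentiable (fun r => complex.Im (F r)) t.
  exact/derivable1_diffP.
move/cvgrPdist_le : cr => /(_ _ e2) cr; move/cvgrPdist_le : ci => /(_ _ e2) ci.
near=> r; apply: le_trans (normc_le_ReIm _) _; rewrite ReD ImD ReN ImN.
rewrite (splitr e); apply: lerD; rewrite distrC; near: r; [exact: cr|exact: ci].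
Unshelve. all: by end_near. Qed.

Lemma sin_lipschitz (x : R) : `|sin x| <= `|x|.
Proof.
have := @mean_value_le sin cos 1 x (fun r => is_derive_sin r).
rewrite sin0 subr0 mul1r; apply => r _.
by rewrite ler_norml cos_geN1 cos_le1.
Qed.

Lemma cos_lipschitz (x : R) : `|cos x - 1| <= `|x|.
Proof.
have := @mean_value_le cos (fun r => - sin r) 1 x (fun r => is_derive_cos r).
rewrite cos0 mul1r; apply => r _.
by rewrite normrN ler_norml sin_geN1 sin_le1.
Qed.

Lemma cos_sub1_le (x : R) : `|cos x - 1| <= x ^+ 2.
Proof.
have := @mean_value_le cos (fun r => - sin r) `|x| x (fun r => is_derive_cos r).
rewrite cos0 -expr2 real_normK ?num_real//; apply => r rx.
by rewrite normrN; apply: le_trans (sin_lipschitz r) rx.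
Qed.

Lemma sin_sub_id_le (x : R) : `|sin x - x| <= x ^+ 2.
Proof.
have h (r : R) : is_derive r 1 (fun r => sin r - r) (cos r - 1).
  exact: is_deriveB.
have := @mean_value_le _ _ `|x| x h.
rewrite sin0 !subr0 -expr2 real_normK ?num_real//; apply => r rx.
by apply: le_trans (cos_lipschitz r) rx.
Qed.

End MeanValue.

(** * Driven oscillators and the rotating frame *)

Section Oscillators.
Context {R : realType} (omega : int -> R).
Implicit Types (x y : state R) (X : R -> state R) (g : R -> int -> R[i]).

(** The group generated by [S1]. *)
Definition rotation (t : R) x : state R :=
  (fun k => (cos (omega k * t))%:C * x.1 k + (sin (omega k * t))%:C * x.2 k,
   fun k => (cos (omega k * t))%:C * x.2 k - (sin (omega k * t))%:C * x.1 k).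

Lemma rotation_modulus t x k :
  normc ((rotation t x).1 k) ^+ 2 + normc ((rotation t x).2 k) ^+ 2 =
  normc (x.1 k) ^+ 2 + normc (x.2 k) ^+ 2.
Proof.
rewrite !sqr_normcE /= !(ReD, ImD, ReN, ImN, ReZ, ImZ).
have := cos2Dsin2 (omega k * t); set c := cos _; set d := sin _ => cd.
set a := complex.Re (x.1 k); set b := complex.Im (x.1 k).
set p := complex.Re (x.2 k); set q := complex.Im (x.2 k).
transitivity ((c ^+ 2 + d ^+ 2) * (a ^+ 2 + b ^+ 2 + (p ^+ 2 + q ^+ 2))).
  by ring.
by rewrite cd mul1r.
Qed.

Lemma energy_rot s t x N : energy s (rotation t x) N = energy s x N.
Proof. by apply: eq_bigr => k _; rewrite rotation_modulus. Qed.

Lemma rotationB t x y : rotation t (x - y) = rotation t x - rotation t y.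
Proof.
case: x y => [x1 x2] [y1 y2]; congr pair; apply/funext => k.
  by rewrite /= !fctE; ring.
by rewrite /= !fctE; ring.
Qed.

Lemma rotationD t r x : rotation (t + r) x = rotation t (rotation r x).
Proof.
by congr pair; apply/funext => k;
  rewrite /= mulrDr cosD sinD !(rmorphD, rmorphB, rmorphN, rmorphM)/=; ring.
Qed.

Lemma rotation0 x : rotation 0 x = x.
Proof.
case: x => x1 x2; congr pair; apply/funext => k;
  by rewrite /= mulr0 cos0 sin0 mul1r mul0r ?addr0 ?subr0.
Qed.

(** Common form of the three equations: for [S1] the force [g] vanishes, for
    [S2] the frequencies do, and for [S1 + S2] the force is the first
    component of [S2]. *)
Definition driven g X := forall t k,
  cderive (fun r => (X r).1 k) ((omega k)%:C * (X t).2 k + g t k) t /\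
  cderive (fun r => (X r).2 k) (- ((omega k)%:C * (X t).1 k)) t.

(** Rotating back leaves only the force: this is the variation of constants
    formula in differential form. *)
Lemma driven_rot g X : driven g X -> forall t k,
  cderive (fun r => (rotation (- r) (X r)).1 k) ((cos (omega k * t))%:C * g t k) t /\
  cderive (fun r => (rotation (- r) (X r)).2 k) ((sin (omega k * t))%:C * g t k) t.
Proof.
move=> gX t k; have [[Xr Xi] [Yr Yi]] := gX t k.
set w := omega k.
have dcos : is_derive t 1 (fun r : R => cos (w * - r)) (- (w * sin (w * t))).
  have dl : is_derive t 1 (fun r : R => w * - r) (- w).
    by apply: is_derive_eq; rewrite /GRing.scale/=; ring.
  apply: is_derive_eq
    (@is_derive1_comp R cos (fun r => w * - r) t _ _ (is_derive_cos (w * - t)) dl) _.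
  by rewrite [w * - t]mulrN sinN; ring.
have dsin : is_derive t 1 (fun r : R => sin (w * - r)) (- (w * cos (w * t))).
  have dl : is_derive t 1 (fun r : R => w * - r) (- w).
    by apply: is_derive_eq; rewrite /GRing.scale/=; ring.
  apply: is_derive_eq
    (@is_derive1_comp R sin (fun r => w * - r) t _ _ (is_derive_sin (w * - t)) dl) _.
  by rewrite [w * - t]mulrN cosN; ring.

have real1 (p q : R -> R) (h : R) : is_derive t 1 p (w * q t + h) ->
    is_derive t 1 q (- (w * p t)) ->
    is_derive t 1 (fun r => cos (w * - r) * p r + sin (w * - r) * q r)
      (cos (w * t) * h).
  move=> dp dq; apply: is_derive_eq.
  by rewrite /GRing.scale/= [w * - t]mulrN cosN sinN; ring.
have real2 (p q : R -> R) (h : R) : is_derive t 1 p (w * q t + h) ->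
    is_derive t 1 q (- (w * p t)) ->
    is_derive t 1 (fun r => cos (w * - r) * q r - sin (w * - r) * p r)
      (sin (w * t) * h).
  move=> dp dq; apply: is_derive_eq.
  by rewrite /GRing.scale/= [w * - t]mulrN cosN sinN; ring.
rewrite !(ReD, ImD, ReN, ImN, ReZ, ImZ) in Xr Xi Yr Yi.
split; split; rewrite ?ReZ ?ImZ.
- under eq_fun do rewrite /= ReD !ReZ; exact: real1.
- under eq_fun do rewrite /= ImD !ImZ; exact: real1.
- under eq_fun do rewrite /= ReD ReN !ReZ; exact: real2.
- under eq_fun do rewrite /= ImD ImN !ImZ; exact: real2.
Qed.

Lemma driven0_rot X : driven (fun _ _ => 0) X -> forall t, X t = rotation t (X 0).
Proof.
move=> X0 t; have /driven_rot dX := X0.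
transitivity (rotation t (rotation (- t) (X t))).
  by rewrite -rotationD subrr rotation0.
congr rotation.
have -> : X 0 = rotation (- 0) (X 0) by rewrite oppr0 rotation0.
rewrite [LHS]surjective_pairing [RHS]surjective_pairing.
congr pair; apply/funext => k.
- rewrite (@cderive_affine _ (fun r => (rotation (- r) (X r)).1 k) 0 t).
    by rewrite mulr0 addr0.
  by move=> r; have := (dX r k).1; rewrite mulr0.
- rewrite (@cderive_affine _ (fun r => (rotation (- r) (X r)).2 k) 0 t).
    by rewrite mulr0 addr0.
  by move=> r; have := (dX r k).2; rewrite mulr0.
Qed.

Lemma rotation_driven x : driven (fun _ _ => 0) (rotation^~ x).
Proof.
move=> t k; set w := omega k.
have dcos : is_derive t 1 (fun r : R => cos (w * r)) (- (w * sin (w * t))).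
  have dl : is_derive t 1 (fun r : R => w * r) w.
    by apply: is_derive_eq; rewrite /GRing.scale/=; ring.
  apply: is_derive_eq
    (@is_derive1_comp R cos ( *%R w) t _ _ (is_derive_cos (w * t)) dl) _.
  by ring.
have dsin : is_derive t 1 (fun r : R => sin (w * r)) (w * cos (w * t)).
  have dl : is_derive t 1 (fun r : R => w * r) w.
    by apply: is_derive_eq; rewrite /GRing.scale/=; ring.
  apply: is_derive_eq
    (@is_derive1_comp R sin ( *%R w) t _ _ (is_derive_sin (w * t)) dl) _.
  by ring.
have real1 (p q : R) : is_derive t 1 (fun r => cos (w * r) * p + sin (w * r) * q)
      (w * (cos (w * t) * q - sin (w * t) * p)).
  by apply: is_derive_eq; rewrite /GRing.scale/=; ring.
have real2 (p q : R) : is_derive t 1 (fun r => cos (w * r) * q - sin (w * r) * p)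
      (- (w * (cos (w * t) * p + sin (w * t) * q))).
  by apply: is_derive_eq; rewrite /GRing.scale/=; ring.
rewrite addr0; split; split; rewrite ?ReN ?ImN ?ReZ ?ImZ.
- under eq_fun do rewrite /= ReD !ReZ; rewrite /= ReD ReN !ReZ; exact: real1.
- under eq_fun do rewrite /= ImD !ImZ; rewrite /= ImD ImN !ImZ; exact: real1.
- under eq_fun do rewrite /= ReD ReN !ReZ; rewrite /= ReD !ReZ; exact: real2.
- under eq_fun do rewrite /= ImD ImN !ImZ; rewrite /= ImD !ImZ; exact: real2.
Qed.

End Oscillators.

Section Trajectories.
Context {R : realType}.
Implicit Types (x y : state R) (X : R -> state R) (g : R -> int -> R[i]).
Implicit Types (omega a : int -> R) (s : R).

Lemma sqr_normcD (z w : R[i]) :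
  normc (z + w) ^+ 2 <= 2 * normc z ^+ 2 + 2 * normc w ^+ 2.
Proof.
apply: le_trans (_ : (normc z + normc w) ^+ 2 <= _).
  by rewrite ler_sqr ?nnegrE ?addr_ge0 ?normc_ge0 ?normcD.
have := sqr_ge0 (normc z - normc w); nra.
Qed.

Lemma sqr_normcB (z w : R[i]) :
  normc (z - w) ^+ 2 <= 2 * normc z ^+ 2 + 2 * normc w ^+ 2.
Proof. by rewrite -(normcN w) sqr_normcD. Qed.

Lemma near_sum_le (t : R) (f : R -> int -> R) :
    (forall k e, 0 < e -> \forall r \near t, f r k <= e) ->
  forall (S : seq int) e, 0 < e -> \forall r \near t, \sum_(k <- S) f r k <= e.
Proof.
move=> f0; elim=> [|k S IH] e e0.
  by near=> r; rewrite big_nil ltW.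
have e2 : 0 < e / 2 by lra.
have := f0 k _ e2; have := IH _ e2; apply: filterS2 => r hS hk.
by rewrite big_cons [leRHS]splitr lerD.
Unshelve. all: by end_near. Qed.

(** The mean value inequality in the rotating frame, where the derivative is
    the force up to a factor of modulus at most one. *)
Lemma driven_profile omega g X a B T : driven omega g X ->
    (forall t k, `|t| <= T -> normc (g t k) <= B * a k) ->
  forall t k, `|t| <= T ->
    normc ((rotation omega (- t) (X t)).1 k - (X 0).1 k) <= 2 * (B * a k) * T /\
    normc ((rotation omega (- t) (X t)).2 k - (X 0).2 k) <= 2 * (B * a k) * T.
Proof.
move=> /driven_rot dX gB t k tT.
have B0 : 0 <= B * a k.
  by apply: le_trans (gB t k tT); exact: normc_ge0.
have e0 : X 0 = rotation omega (- 0) (X 0) by rewrite oppr0 rotation0.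
split.
- apply: le_trans (_ : 2 * (B * a k) * `|t| <= _); last first.
    by rewrite ler_wpM2l// mulr_ge0.
  rewrite [X in normc (_ - X.1 k)]e0.
  apply: cderive_lipschitz (fun r => (dX r k).1) _ => r rt.
  rewrite normcZ; apply: le_trans (gB r k (le_trans rt tT)).
  by rewrite ler_piMl ?normc_ge0// ler_norml cos_geN1 cos_le1.
- apply: le_trans (_ : 2 * (B * a k) * `|t| <= _); last first.
    by rewrite ler_wpM2l// mulr_ge0.
  rewrite [X in normc (_ - X.2 k)]e0.
  apply: cderive_lipschitz (fun r => (dX r k).2) _ => r rt.
  rewrite normcZ; apply: le_trans (gB r k (le_trans rt tT)).
  by rewrite ler_piMl ?normc_ge0// ler_norml sin_geN1 sin_le1.
Qed.

(** The modes are dominated, locally uniformly in time, by a square summable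
    sequence; hence the high modes are uniformly small, and the finitely many
    others are continuous. *)
Lemma driven_continuous omega g X a s L : driven omega g X -> hs s (X 0) ->
    (forall N, \sum_(k <- window N) (weight s k * a k) ^+ 2 <= L) ->
    (forall T, exists B, forall t k, `|t| <= T -> normc (g t k) <= B * a k) ->
  (forall t, hs s (X t)) /\
  (forall t, norm_hs s (X r - X t) @[r --> t] --> 0%E).
Proof.
move=> dX /hs_normP[n [n0 _ Xn]] aL gB.
pose d x k := weight s k ^+ 2 * (normc (x.1 k) ^+ 2 + normc (x.2 k) ^+ 2).
have d0 x k : 0 <= d x k.
  by rewrite mulr_ge0 ?sqr_ge0// addr_ge0 ?sqr_ge0.
(* The dominating sequence is found in the rotating frame, where each mode has
   the same energy. *)
have dom T : exists D : int -> R, [/\ forall k, 0 <= D k,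
    exists L', forall N, \sum_(k <- window N) D k <= L' &
    forall t k, `|t| <= T -> d (X t) k <= D k].
  have [B gBT] := gB T; pose c := 2 * B * T.
  exists (fun k => 2 * d (X 0) k + 4 * c ^+ 2 * (weight s k * a k) ^+ 2); split.
  - move=> k; have := d0 (X 0) k; have := sqr_ge0 (weight s k * a k).
    have := sqr_ge0 c; nra.
  - exists (2 * n ^+ 2 + 4 * c ^+ 2 * L) => N.
    rewrite big_split/= -!mulr_sumr; apply: lerD; rewrite ler_wpM2l//.
      exact: Xn.
    by rewrite mulr_ge0 ?sqr_ge0.
  - move=> t k tT; have [h1 h2] := driven_profile dX gBT k tT.
    rewrite /d -(rotation_modulus omega (- t) (X t)).
    set y := rotation _ _ _ in h1 h2 *; set x := X 0 in h1 h2 *.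
    have sq (z w : R[i]) : normc (z - w) <= 2 * (B * a k) * T ->
        normc z ^+ 2 <= 2 * normc w ^+ 2 + 2 * (c * a k) ^+ 2.
      move=> zw; rewrite -{1}(subrK w z) addrC.
      apply: le_trans (sqr_normcD _ _) _; rewrite lerD2l ler_wpM2l//.
      have -> : c * a k = 2 * (B * a k) * T by rewrite /c; ring.
      by rewrite ler_sqr ?nnegrE ?normc_ge0// (le_trans _ zw) ?normc_ge0.
    have := lerD (sq _ _ h1) (sq _ _ h2).
    move=> /(ler_wpM2l (sqr_ge0 (weight s k))) /le_trans; apply.
    by apply: le_of_eq; rewrite /d; ring.
split=> [t|t].
  have [D [D0 [L' DL] Dd]] := dom `|t|.
  apply: (@hs_energy _ _ _ L') => N; apply: le_trans (DL N).
  by apply: ler_sum => k _; exact: Dd.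
have [D [D0 [L' DL] Dd]] := dom (`|t| + 1).
have dXX r k : `|r| <= `|t| + 1 -> d (X r - X t) k <= 4 * D k.
  move=> rt; have h1 := Dd r k rt; have h2 : d (X t) k <= D k.
    by apply: Dd; rewrite lerDl.
  apply: le_trans (_ : 2 * d (X r) k + 2 * d (X t) k <= _); last by lra.
  rewrite /d !(mulrCA 2) -mulrDr ler_wpM2l ?sqr_ge0//.
  rewrite -[(X r - X t).1 k]/((X r).1 k - (X t).1 k).
  rewrite -[(X r - X t).2 k]/((X r).2 k - (X t).2 k).
  have := sqr_normcB ((X r).1 k) ((X t).1 k).
  have := sqr_normcB ((X r).2 k) ((X t).2 k).
  lra.
have near_d k e : 0 < e -> \forall r \near t, d (X r - X t) k <= e.
  move=> e0; set w := weight s k ^+ 2.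
  have w0 : 0 < w by rewrite exprn_gt0// weight_gt0.
  pose del := Num.sqrt (e / (2 * w)).
  have ew : 0 < e / (2 * w) by rewrite divr_gt0// mulr_gt0.
  have del0 : 0 < del by rewrite sqrtr_gt0.
  have [d1 d2] := dX t k.
  have := cderive_cont d1 del0; have := cderive_cont d2 del0.
  apply: filterS2 => r h2 h1; rewrite /d -/w.
  have -> : e = w * (del ^+ 2 + del ^+ 2).
    by rewrite sqr_sqrtr ?ltW//; field; rewrite gt_eqF.
  rewrite ler_pM2l//.
  by apply: lerD; rewrite ler_sqr ?nnegrE ?normc_ge0 ?(ltW del0).
have small e : 0 < e -> \forall r \near t, (norm_hs s (X r - X t)%R <= e%:E)%E.
  move=> e0; have e2 : 0 < e ^+ 2 / 2 by rewrite divr_gt0 ?exprn_gt0.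
  have D4 k : 0 <= 4 * D k by rewrite mulr_ge0.
  have D4L N : \sum_(k <- window N) 4 * D k <= 4 * L'.
    by rewrite -mulr_sumr ler_wpM2l.
  have [N0 tail] := window_tail D4 D4L e2.
  have near1 : \forall r \near t, `|r| <= `|t| + 1.
    have /cvgrPdist_le/(_ _ ltr01) := @cvg_id _ (nbhs t).
    apply: filterS => r; rewrite distrC => rt.
    by rewrite -(subrK t r) addrC (le_trans (ler_normD _ _))// lerD2l.
  have := near_sum_le near_d (window N0) e2; move: near1.
  apply: filterS2 => r rt head; apply/norm_hs_leP; first exact: ltW.
  move=> N; rewrite /energy (bigID (fun k => `|k| <= N0)%N)/= [leRHS]splitr.
  apply: lerD.
    apply: le_trans head; rewrite -big_filter; apply: ler_sum_uniq.
    - by move=> k; exact: (d0 (X r - X t) k).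
    - by rewrite filter_uniq// window_uniq.
    - exact: window_uniq.
    - by move=> k; rewrite mem_filter !mem_window => /andP[].
  apply: le_trans (tail N); under [leRHS]eq_bigl do rewrite ltnNge.
  by apply: ler_sum => k _; exact: dXX.
apply/fine_cvgP; split.
  have := small _ ltr01; apply: filterS => r h.
  by rewrite ge0_fin_numE ?norm_hs_ge0// (le_lt_trans h)// ltry.
apply/cvgrPdist_le => e e0; have := small _ e0; apply: filterS => r h /=.
rewrite sub0r normrN ger0_norm ?fine_ge0 ?norm_hs_ge0//.
rewrite -lee_fin fineK// ge0_fin_numE ?norm_hs_ge0//.
by rewrite (le_lt_trans h)// ltry.
Qed.

End Trajectories.

(** * Everywhere convergent exponential series *)

Section EntireCurves.
Context {R : realType}.
Implicit Types (c : nat -> R) (u v z w : nat -> R[i]) (K t T : R).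

Lemma geometric_tail c K : (forall j, `|c j| <= K * 2^-1 ^+ j) ->
  cvgn (series c) /\
  forall n, `|limn (series c) - series c n| <= 2 * K * 2^-1 ^+ n.
Proof.
move=> cK; have cc : cvgn (series c).
  apply: normed_cvg; apply: (series_le_cvg _ _ cK) => [//|j|].
    exact: le_trans (cK j).
  by apply: is_cvg_geometric_series; rewrite ger0_norm// invf_lt1// ltr1n.
split=> // n; have h0 j : 0 <= 2^-1 ^+ j :> R by rewrite exprn_ge0.
have K0 : 0 <= K.
  by have := cK 0%N; rewrite expr0 mulr1; exact: le_trans.
have part p : `|series c (p + n)%N - series c n| <=
    2 * K * 2^-1 ^+ n - 2 * K * 2^-1 ^+ (p + n)%N.
  elim: p => [|p IH]; first by rewrite add0n !subrr normr0.
  rewrite addSn seriesSr addrAC exprS.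
  apply: le_trans (ler_normD _ _) _; have := cK (p + n)%N.
  have e : 2 * (2^-1 * 2^-1 ^+ (p + n)) = 2^-1 ^+ (p + n) :> R.
    by rewrite mulrA divff// mul1r.
  set y := 2^-1 ^+ (p + n) in IH e *; nra.
have lim_sub : (fun p => series c (p + n)%N - series c n) @ \oo -->
    limn (series c) - series c n.
  by apply: cvgB; [rewrite cvg_shiftn|exact: cvg_cst].
have lim_norm : `|series c (p + n)%N - series c n| @[p --> \oo] -->
    `|limn (series c) - series c n| by apply: cvg_norm.
rewrite -(cvg_lim _ lim_norm)//; apply: limr_le.
  by apply/cvg_ex; eexists; exact: lim_norm.
apply: nearW => p; apply: le_trans (part p) _.
by rewrite gerBl mulr_ge0// mulr_ge0.
Qed.

Definition cseries u : R[i] :=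
  limn (series (fun j => complex.Re (u j))) +i*
  limn (series (fun j => complex.Im (u j))).

Definition geometric_le u K := forall j, normc (u j) <= K * 2^-1 ^+ j.

Lemma cseries_tail u K n : geometric_le u K ->
  normc (cseries u - \sum_(0 <= j < n) u j) <= 4 * K * 2^-1 ^+ n.
Proof.
move=> uK.
have [_ /(_ n) hr] : cvgn (series (fun j => complex.Re (u j))) /\ _ :=
  geometric_tail (fun j => le_trans (ler_Re_normc (u j)) (uK j)).
have [_ /(_ n) hi] : cvgn (series (fun j => complex.Im (u j))) /\ _ :=
  geometric_tail (fun j => le_trans (ler_Im_normc (u j)) (uK j)).
apply: le_trans (normc_le_ReIm _) _; rewrite ReD ImD ReN ImN Re_sum Im_sum.
have -> : 4 * K * 2^-1 ^+ n = 2 * K * 2^-1 ^+ n + 2 * K * 2^-1 ^+ n by ring.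
exact: lerD.
Qed.

Lemma cseries_le u K : geometric_le u K -> normc (cseries u) <= 4 * K.
Proof.
by move=> /(cseries_tail 0); rewrite big_geq// subr0 expr0 mulr1.
Qed.

(** This identifies the image of a sum under an operation that is compatible
    with partial sums up to a geometric error. *)
Lemma cseries_unique u K l C : geometric_le u K ->
  (forall n, normc (l - \sum_(0 <= j < n) u j) <= C * 2^-1 ^+ n) ->
  l = cseries u.
Proof.
move=> uK lC; apply/eqP; rewrite -subr_eq0; apply/eqP/Normc.eq0_normc.
apply/eqP; rewrite eq_le normc_ge0 andbT.
have h : (fun n => (C + 4 * K) * 2^-1 ^+ n) @ \oo --> (0 : R).
  by apply: cvg_geometric; rewrite ger0_norm// invf_lt1// ltr1n.
rewrite -(cvg_lim _ h)//; apply: limr_ge; first by apply/cvg_ex; exists 0.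
apply: nearW => n; rewrite mulrDl; have := lerD (lC n) (cseries_tail n uK).
apply: le_trans; apply: le_trans (normcB _ _); apply: le_of_eq.
by congr normc; ring.
Qed.

Lemma cseries_linear u v (a : R) K K' :
  geometric_le u K -> geometric_le v K' ->
  cseries (fun j => a%:C * u j + v j) = a%:C * cseries u + cseries v.
Proof.
move=> uK vK'; apply/esym.
have le_lin (p q : R[i]) : normc (a%:C * p + q) <= `|a| * normc p + normc q.
  by rewrite -normcZ normcD.
apply: (@cseries_unique _ (`|a| * K + K') _ (`|a| * (4 * K) + 4 * K')) => [j|n].
  apply: le_trans (le_lin _ _) _; rewrite mulrDl -mulrA.
  by rewrite lerD// ler_wpM2l.
rewrite big_split/= -mulr_sumr.
have -> (p q r s : R[i]) : a%:C * p + q - (a%:C * r + s) =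
  a%:C * (p - r) + (q - s) by ring.
apply: le_trans (le_lin _ _) _; rewrite mulrDl -mulrA.
apply: lerD; last exact: cseries_tail.
by rewrite ler_wpM2l// cseries_tail.
Qed.

(** Coefficients of an exponential series [sum_j t^j / j! z_j] that converges
    for all [t].  A geometric bound at every radius is asked for, because it
    is stable under the shift that differentiates the series. *)
Definition entire z := forall T, 0 < T -> exists K,
  geometric_le (fun j => (T ^+ j / j`!%:R)%:C * z j) K.

Definition expseries z t : R[i] :=
  cseries (fun j => (t ^+ j / j`!%:R)%:C * z j).

Lemma geometric_le_time z K t T : `|t| <= T ->
  geometric_le (fun j => (T ^+ j / j`!%:R)%:C * z j) K ->
  geometric_le (fun j => (t ^+ j / j`!%:R)%:C * z j) K.
Proof.
move=> tT zK j; apply: le_trans (zK j); rewrite !normcZ ler_wpM2r ?normc_ge0//.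
rewrite !normrM ler_wpM2r// !normrX lerXn2r ?nnegrE//.
by rewrite (le_trans tT) ?ler_norm.
Qed.

(** The factor [j + 1] lost by differentiation is absorbed by doubling the
    radius. *)
Lemma entire_shift z : entire z -> entire (fun j => z j.+1).
Proof.
move=> ez T T0; have T20 : 0 < 2 * T by rewrite mulr_gt0.
have [K zK] := ez _ T20; exists (K / T) => j; have := zK j.+1.
rewrite !normcZ !ger0_norm ?divr_ge0 ?exprn_ge0 ?(ltW T0) ?(ltW T20)//.
have f0 : (j`!%:R : R) != 0 by rewrite pnatr_eq0 -lt0n fact_gt0.
have j0 : (j.+1%:R : R) != 0 by rewrite pnatr_eq0.
have -> : (2 * T) ^+ j.+1 / j.+1`!%:R * normc (z j.+1) =
    (2 ^+ j.+1 / j.+1%:R) * (T * (T ^+ j / j`!%:R * normc (z j.+1))).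
  by rewrite exprMn (exprS T) factS natrM; field; rewrite f0 nat1r.
set y := _ * normc _ => h.
have y0 : 0 <= T * y.
  by rewrite !mulr_ge0 ?normc_ge0 ?invr_ge0 ?exprn_ge0 ?(ltW T0).
have e1 : 1 <= 2 ^+ j.+1 / j.+1%:R :> R.
  by rewrite ler_pdivlMr// mul1r -natrX ler_nat ltnW// ltn_expl.
have K0 : 0 <= K.
  have := zK 0%N; rewrite expr0 mulr1; apply: le_trans; exact: normc_ge0.
have h2 : 2^-1 ^+ j.+1 <= 2^-1 ^+ j :> R.
  by rewrite exprS ger_pMl ?exprn_gt0// invf_le1// ler1n.
rewrite mulrAC ler_pdivlMr// mulrC.
apply: le_trans (_ : K * 2^-1 ^+ j.+1 <= _); last by rewrite ler_wpM2l.
by apply: le_trans h; rewrite ler_peMl.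
Qed.

Lemma expseries_cderive z t : entire z ->
  cderive (expseries z) (expseries (fun j => z j.+1) t) t.
Proof.
move=> ez.
have real (p : R[i] -> R) :
    (forall (a : R) y, p (a%:C * y) = a * p y) ->
    (forall y, `|p y| <= normc y) ->
    is_derive t 1
      (fun r => limn (series (fun j => p ((r ^+ j / j`!%:R)%:C * z j))))
      (limn (series (fun j => p ((t ^+ j / j`!%:R)%:C * z j.+1)))).
  move=> pZ ple.
  pose d j := p (z j) / j`!%:R.
  have diffE (w : nat -> R[i]) : pseries_diffs (fun j => p (w j) / j`!%:R) =
      (fun j => p (w j.+1) / j`!%:R).
    apply/funext => j; rewrite /pseries_diffs factS natrM.
    have f0 : (j`!%:R : R) != 0 by rewrite pnatr_eq0 -lt0n fact_gt0.
    have j0 : (j.+1%:R : R) != 0 by rewrite pnatr_eq0.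
    by field; rewrite f0 nat1r.
  have psE (w : nat -> R[i]) r : pseries (fun j => p (w j) / j`!%:R) r =
      series (fun j => p ((r ^+ j / j`!%:R)%:C * w j)).
    rewrite /pseries; congr series; apply/funext => j; rewrite pZ.
    by rewrite mulrC mulrA mulrAC.
  have pcv (w : nat -> R[i]) r : 0 < r -> entire w ->
      cvgn (pseries (fun j => p (w j) / j`!%:R) r).
    move=> r0 /(_ _ r0)[K wK]; rewrite psE.
    by have [] := geometric_tail (fun j => le_trans (ple _) (wK j)).
  have T0 : 0 < `|t| + 1 by rewrite ltr_wpDl.
  have tT : `|t| < `| `|t| + 1| by rewrite [ltRHS]gtr0_norm// ltrDl.
  have -> : (fun r => limn (series (fun j => p ((r ^+ j / j`!%:R)%:C * z j)))) =
      (fun r => limn (pseries d r)).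
    by apply/funext => r; rewrite psE.
  rewrite -(psE (fun j => z j.+1)) -diffE.
  apply: (@pseries_snd_diffs R d (`|t| + 1) t) => //; rewrite ?diffE.
  - exact: pcv.
  - by apply: (pcv (fun j => z j.+1)) => //; exact: entire_shift.
  - apply: (pcv (fun j => z j.+2)) => //.
    by apply: (@entire_shift (fun j => z j.+1)); exact: entire_shift.
split; first exact: (real (@complex.Re R) (@ReZ R) (@ler_Re_normc R)).
exact: (real (@complex.Im R) (@ImZ R) (@ler_Im_normc R)).
Qed.

Lemma expseries0 z : expseries z 0 = z 0%N.
Proof.
apply/esym; apply: (@cseries_unique _ (normc (z 0%N)) _ (normc (z 0%N))).
  case=> [|j]; first by rewrite expr0 fact0 divr1 mul1r mulr1.
  by rewrite expr0n/= mul0r mul0r Normc.normc0 mulr_ge0 ?normc_ge0 ?exprn_ge0.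
case=> [|n]; first by rewrite big_geq// subr0 mulr1.
rewrite big_nat_recl// expr0 fact0 divr1 mul1r big1 => [|j _].
  by rewrite addr0 subrr Normc.normc0 mulr_ge0 ?normc_ge0 ?exprn_ge0.
by rewrite expr0n/= mul0r mul0r.
Qed.

End EntireCurves.

(** * Oscillators coupled by a smoothing operator: existence *)

Section CoupledOscillators.
Context {R : realType} (s : R) (s_ge0 : 0 <= s).
Context (omega a : int -> R) (A : int -> int -> R[i]).
Context (omega_ge0 : forall k, 0 <= omega k) (a_ge0 : forall k, 0 <= a k).
Context (A_le : forall k m, normc (A k m) <= a k * a m).
Context (a_decay : forall sigma, exists C, forall k,
  weight s k * a k * expR (sigma * omega k) <= C * invsq k).
Implicit Types (x y : state R) (X : R -> state R) (u : int -> R[i]).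

Definition skew x : state R := (multiplier omega x.2, - multiplier omega x.1).

Definition coupling x : state R :=
  (fun k => zsum (fun m => A k m * x.2 m), 0).

Lemma profile_sum sigma : exists L, [/\ 0 <= L,
  forall k, weight s k * a k * expR (sigma * omega k) <= L * invsq k,
  forall k, a k * expR (sigma * omega k) <= L &
  forall N, \sum_(k <- window N) a k * expR (sigma * omega k) <= L].
Proof.
have [C aC] := a_decay sigma.
have p0 k : 0 <= a k * expR (sigma * omega k) by rewrite mulr_ge0 ?expR_ge0.
have pC k : a k * expR (sigma * omega k) <= C * invsq k.
  by apply: le_trans (aC k); rewrite -mulrA ler_peMl// weight_ge1.
have C0 : 0 <= C.
  by rewrite -(pmulr_lge0 _ (invsq_gt0 0)); exact: le_trans (pC 0).
have i0 k : 0 <= invsq k :> R by rewrite ltW ?invsq_gt0.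
exists (3 * C); split.
- by rewrite mulr_ge0.
- by move=> k; apply: le_trans (aC k) _; have := i0 k; nra.
- move=> k; apply: le_trans (pC k) _; have := i0 k.
  by have := @invsq_le1 R k; nra.
- move=> N; apply: (@le_trans _ _ (\sum_(k <- window N) C * invsq k)).
    exact: ler_sum.
  by rewrite -mulr_sumr mulrC ler_wpM2r// sum_invsq.
Qed.

Lemma coupling_term_le k m z B (p : R) : normc z <= B * p ->
  normc (A k m * z) <= a k * B * (a m * p).
Proof.
move=> zB; rewrite Normc.normcM.
apply: le_trans (ler_pM (normc_ge0 _) (normc_ge0 _) (A_le k m) zB) _.
by apply: le_of_eq; ring.
Qed.

Lemma coupling_summable k u B (p : int -> R) L :
    (forall m, normc (u m) <= B * p m) ->
    (forall N, \sum_(m <- window N) a m * p m <= L) -> 0 <= B ->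
  abs_summable (fun m => A k m * u m).
Proof.
move=> uB pL B0.
apply: (@abs_summable_le _ _ (fun m => a k * B * (a m * p m)) (a k * B * L)).
  by move=> m; exact: coupling_term_le.
by move=> N; rewrite -mulr_sumr ler_wpM2l// mulr_ge0.
Qed.

Lemma coupling_le k u B (p : int -> R) L :
    (forall m, normc (u m) <= B * p m) ->
    (forall N, \sum_(m <- window N) a m * p m <= L) -> 0 <= B ->
  normc (zsum (fun m => A k m * u m)) <= 2 * (B * L) * a k.
Proof.
move=> uB pL B0; have -> : 2 * (B * L) * a k = 2 * (a k * B * L) by ring.
apply: (@normc_zsum_le _ _ (fun m => a k * B * (a m * p m))).
  by move=> m; exact: coupling_term_le.
by move=> N; rewrite -mulr_sumr ler_wpM2l// mulr_ge0.
Qed.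

Let full := skew \+ coupling.

Lemma full1 x k : (full x).1 k =
  (omega k)%:C * x.2 k + zsum (fun m => A k m * x.2 m).
Proof. by []. Qed.

Lemma full2 x k : (full x).2 k = - ((omega k)%:C * x.1 k).
Proof. by rewrite /full /= addr0. Qed.

Let iterates x j := iter j full x.

(** Along the scale of weights [exp (sigma * omega k)] the rotation loses an
    arbitrarily small amount of [sigma] at the price of its inverse, and the
    coupling, being smoothing, is bounded; [j] equal losses give a bound of
    the [j]-th iterate of Cauchy-Kovalevskaya type. *)
Lemma iterates_scale x n sigma L j : 0 <= n -> 0 < sigma -> 0 <= L ->
    (forall k, normc (x.1 k) <= n /\ normc (x.2 k) <= n) ->
    (forall N, \sum_(k <- window N) a k * expR (sigma * omega k) <= L) ->
    (forall k, a k * expR (sigma * omega k) <= L) ->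
  forall i, (i <= j)%N -> forall k,
    normc ((iterates x i).1 k) <=
      n * (j%:R / sigma + 2 * L * L) ^+ i * expR (i%:R / j%:R * sigma * omega k)
    /\ normc ((iterates x i).2 k) <=
      n * (j%:R / sigma + 2 * L * L) ^+ i * expR (i%:R / j%:R * sigma * omega k).
Proof.
move=> n0 sg0 L0 xn aL aL1; elim=> [|i IH] ij k.
  by rewrite !mul0r expR0 expr0 !mulr1; exact: xn.
have {}IH := IH (ltnW ij); set r := j%:R / sigma + 2 * L * L in IH *.
have j0 : 0 < j%:R :> R by rewrite ltr0n (leq_trans _ ij).
have r0 : 0 <= r.
  by rewrite addr_ge0 ?mulr_ge0 ?invr_ge0 ?(ltW sg0).
set B := n * r ^+ i in IH *; have B0 : 0 <= B by rewrite mulr_ge0 ?exprn_ge0.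
have -> : n * r ^+ i.+1 = B * r by rewrite exprSr mulrA.
clearbody B; set W := expR (i.+1%:R / j%:R * sigma * omega k).
set V := expR (i%:R / j%:R * sigma * omega k) in IH *.
have W1 : 1 <= W.
  by rewrite -expR0 ler_expR !mulr_ge0 ?invr_ge0 ?(ltW sg0).
have V0 : 0 <= V := expR_ge0 _.
have VW : omega k * V <= j%:R / sigma * W.
  have -> : W = expR (sigma / j%:R * omega k) * V.
    rewrite /W /V -expRD; congr expR; rewrite -natr1; field.
    by rewrite gt_eqF.
  rewrite mulrA ler_wpM2r//.
  set q := sigma / j%:R * omega k.
  have -> : omega k = j%:R / sigma * q by rewrite /q; field; rewrite !gt_eqF.
  rewrite ler_wpM2l ?divr_ge0 ?(ltW sg0)//.
  by apply: le_trans (expR_ge1Dx q); rewrite lerDr.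
have main (z : R[i]) : normc z <= B * V ->
    normc ((omega k)%:C * z) <= B * (j%:R / sigma) * W.
  move=> zB; rewrite normcZ ger0_norm//.
  apply: le_trans (ler_wpM2l (omega_ge0 k) zB) _.
  by rewrite mulrCA -mulrA ler_wpM2l.
have sg k' : expR (i%:R / j%:R * sigma * omega k') <= expR (sigma * omega k').
  rewrite ler_expR ler_wpM2r// ler_piMl ?(ltW sg0)// ler_pdivrMr// mul1r ler_nat.
  exact: ltnW.
split.
- rewrite /iterates iterS full1; apply: le_trans (normcD _ _) _.
  rewrite mulrDr mulrDl; apply: lerD; first by apply: main; exact: (IH k).2.
  apply: le_trans (@coupling_le k _ B _ L _ aL B0) _.
    by move=> m; apply: le_trans (IH m).2 _; rewrite ler_wpM2l.
  have akL : a k <= L.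
    apply: le_trans (aL1 k); rewrite ler_peMr// -expR0 ler_expR mulr_ge0//.
    exact: ltW.
  have -> : B * (2 * L * L) * W = 2 * (B * L) * L * W by ring.
  apply: le_trans (_ : 2 * (B * L) * L <= _).
    by rewrite ler_wpM2l// !mulr_ge0.
  by rewrite ler_peMr// !mulr_ge0.
- rewrite /iterates iterS full2 normcN; apply: le_trans (main _ (IH k).1) _.
  by rewrite ler_wpM2r ?(le_trans ler01)// ler_wpM2l// lerDl !mulr_ge0.
Qed.

Lemma expn_le_expR (y : R) j : 0 <= y -> y ^+ j / j`!%:R <= expR y.
Proof.
case: j => [|j] y0.
  by rewrite expr0 fact0 divr1 -expR0 ler_expR.
by apply: le_trans (expR_ge1Dxn j y0); rewrite lerDr.
Qed.

(** The weight [sigma = 8 T] leaves a geometric decay at the radius [T]. *)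
Lemma iterates_entire x n T : 0 <= n -> 0 < T ->
    (forall k, normc (x.1 k) <= n /\ normc (x.2 k) <= n) ->
  exists K sigma, [/\ 0 <= K, 0 <= sigma & forall k,
    geometric_le (fun j => (T ^+ j / j`!%:R)%:C * (iterates x j).1 k)
      (K * expR (sigma * omega k)) /\
    geometric_le (fun j => (T ^+ j / j`!%:R)%:C * (iterates x j).2 k)
      (K * expR (sigma * omega k))].
Proof.
move=> n0 T0 xn; pose sigma := 8 * T; have sg0 : 0 < sigma by rewrite mulr_gt0.
have [L [L0 _ aL1 aL]] := profile_sum sigma.
exists (n * expR (8 * T * L * L)), sigma; split.
- by rewrite mulr_ge0// expR_ge0.
- exact: ltW.
move=> k.
suff coef (z : nat -> R[i]) : (forall j, normc (z j) <=
      n * (j%:R / sigma + 2 * L * L) ^+ j * expR (sigma * omega k)) ->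
    geometric_le (fun j => (T ^+ j / j`!%:R)%:C * z j)
      (n * expR (8 * T * L * L) * expR (sigma * omega k)).
  have E j : expR (j%:R / j%:R * sigma * omega k) <= expR (sigma * omega k).
    rewrite ler_expR ler_wpM2r// ler_piMl ?(ltW sg0)//.
    by case: j => [|j]; rewrite ?mul0r// divff// pnatr_eq0.
  have r0 j : 0 <= n * (j%:R / sigma + 2 * L * L) ^+ j.
    by rewrite mulr_ge0 ?exprn_ge0// addr_ge0 ?mulr_ge0 ?invr_ge0 ?(ltW sg0).
  by split; apply: coef => j;
    have [h1 h2] := iterates_scale n0 sg0 L0 xn aL aL1 (leqnn j) k;
    [apply: le_trans h1 _|apply: le_trans h2 _]; rewrite ler_wpM2l.
move=> zB j; rewrite normcZ ger0_norm ?divr_ge0 ?exprn_ge0 ?(ltW T0)//.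
set r := j%:R / sigma + 2 * L * L.
have r0 : 0 <= r.
  by rewrite addr_ge0 ?mulr_ge0 ?invr_ge0 ?(ltW sg0).
have T40 : 0 <= 4 * T * r by rewrite !mulr_ge0// ltW.
(* [y ^ j / j! <= exp y] for [y = 4 T r], where [exp (j / 2) <= 2 ^ j]. *)
have key : T ^+ j / j`!%:R * r ^+ j <= expR (8 * T * L * L) * 2^-1 ^+ j.
  have := expn_le_expR j T40.
  have -> : 4 * T * r = j%:R * 2^-1 + 8 * T * L * L.
    by rewrite /r /sigma; field; rewrite gt_eqF.
  rewrite expRD expRM_natl => h.
  have half : expR (2^-1) <= 2 :> R.
    have := expR_ge1Dx (- 2^-1 : R); rewrite expRN => h2.
    rewrite -[leLHS]invrK -[leRHS]invrK lef_pV2 ?posrE ?invr_gt0 ?expR_gt0//.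
    by apply: le_trans h2; lra.
  have h3 : expR (2^-1) ^+ j <= 2 ^+ j :> R by rewrite lerXn2r ?nnegrE ?expR_ge0.
  have -> : T ^+ j / j`!%:R * r ^+ j = 4^-1 ^+ j * ((4 * T * r) ^+ j / j`!%:R).
    by rewrite !exprMn exprVn; field; rewrite expf_neq0 ?pnatr_eq0// -lt0n fact_gt0.
  have -> : 4 * T * r = j%:R * 2^-1 + 8 * T * L * L.
    by rewrite /r /sigma; field; rewrite gt_eqF.
  apply: le_trans (ler_wpM2l _ h) _; first by rewrite exprn_ge0.
  rewrite mulrA mulrC ler_wpM2l ?expR_ge0//.
  apply: le_trans (ler_wpM2l _ h3) _; first by rewrite exprn_ge0.
  by rewrite -exprMn; apply: le_of_eq; congr (_ ^+ j); lra.
have {zB} := zB j; rewrite -/r; set E := expR (sigma * omega k) => zB.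
have E0 : 0 <= E := expR_ge0 _.
apply: le_trans (ler_wpM2l _ zB) _.
  by rewrite divr_ge0 ?exprn_ge0 ?(ltW T0).
have -> : T ^+ j / j`!%:R * (n * r ^+ j * E) =
  n * E * (T ^+ j / j`!%:R * r ^+ j) by ring.
apply: le_trans (ler_wpM2l (mulr_ge0 n0 E0) key) _.
by apply: le_of_eq; ring.
Qed.

Lemma coupling_sum k (p : int -> R) L (B : nat -> R) (z : nat -> int -> R[i]) n :
    (forall N, \sum_(m <- window N) a m * p m <= L) -> (forall j, 0 <= B j) ->
    (forall j m, normc (z j m) <= B j * p m) ->
  zsum (fun m => A k m * \sum_(0 <= j < n) z j m) =
  \sum_(0 <= j < n) zsum (fun m => A k m * z j m).
Proof.
move=> pL B0 zB.
have sums i m :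
    normc (\sum_(0 <= j < i) z j m) <= (\sum_(0 <= j < i) B j) * p m.
  elim: i => [|i IH]; first by rewrite !big_geq// mul0r Normc.normc0.
  rewrite !big_nat_recr//= mulrDl; apply: le_trans (normcD _ _) _.
  by rewrite lerD.
elim: n => [|n IH].
  rewrite big_geq// -[RHS](@zsum0 R); congr zsum; apply/funext => m.
  by rewrite big_geq// mulr0.
rewrite big_nat_recr//= -IH -[X in _ = _ + X]mul1r -zsum_linear.
- by congr zsum; apply/funext => m; rewrite big_nat_recr//= mulrDr mul1r.
- by apply: coupling_summable (sums n) pL _; rewrite sumr_ge0.
- exact: coupling_summable (zB n) pL (B0 n).
Qed.

(** The exponential series of the iterates solves the equation mode by mode.
    Its modes may grow like [exp (sigma * omega k)], but the force they exert
    is again bounded by the profile. *)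
Lemma coupled_solution x n : 0 <= n ->
    (forall k, normc (x.1 k) <= n /\ normc (x.2 k) <= n) ->
  exists X, [/\ X 0 = x,
    driven omega (fun t k => zsum (fun m => A k m * (X t).2 m)) X &
    forall T, exists B, forall t k, `|t| <= T ->
      normc (zsum (fun m => A k m * (X t).2 m)) <= B * a k].
Proof.
move=> n0 xn; pose e := iterates x.
pose X t : state R := (fun k => expseries (fun j => (e j).1 k) t,
                       fun k => expseries (fun j => (e j).2 k) t).
have ent k : entire (fun j => (e j).1 k) /\ entire (fun j => (e j).2 k).
  split=> T T0; have [K [sigma [_ _ h]]] := iterates_entire n0 T0 xn.
    by eexists; exact: (h k).1.
  by eexists; exact: (h k).2.
have XT T : exists K sigma, [/\ 0 <= K, 0 <= sigma & forall t k, `|t| <= T ->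
    geometric_le (fun j => (t ^+ j / j`!%:R)%:C * (e j).2 k)
      (K * expR (sigma * omega k))].
  have T0 : 0 < `|T| + 1 by rewrite ltr_wpDl.
  have [K [sigma [K0 sg0 h]]] := iterates_entire n0 T0 xn.
  exists K, sigma; split=> // t k tT; apply: geometric_le_time (h k).2.
  by rewrite (le_trans tT)// (le_trans (ler_norm _))// lerDl.
(* The coupling may be applied to the series term by term. *)
have swap t k : exists2 M,
    geometric_le (fun j => (t ^+ j / j`!%:R)%:C *
      zsum (fun m => A k m * (e j).2 m)) M &
    expseries (fun j => zsum (fun m => A k m * (e j).2 m)) t =
    zsum (fun m => A k m * (X t).2 m).
  have [K [sigma [K0 sg0 h]]] := XT `|t|.
  have [L [L0 _ _ aL]] := profile_sum sigma.
  pose z j m := (t ^+ j / j`!%:R)%:C * (e j).2 m.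
  have {}h m : geometric_le (z^~ m) (K * expR (sigma * omega m)) := h t m (lexx _).
  have half j : 0 <= K * 2^-1 ^+ j by rewrite mulr_ge0 ?exprn_ge0.
  have zK j m : normc (z j m) <= K * 2^-1 ^+ j * expR (sigma * omega m).
    by rewrite mulrAC; exact: h.
  have Az j : (t ^+ j / j`!%:R)%:C * zsum (fun m => A k m * (e j).2 m) =
      zsum (fun m => A k m * z j m).
    have E : (fun m => A k m * z j m) =
        (fun m => (t ^+ j / j`!%:R)%:C * (A k m * (e j).2 m)).
      by apply/funext => m; rewrite mulrCA.
    by rewrite -zsumZ -E//; exact: coupling_summable (zK j) aL (half j).
  have zM : geometric_le (fun j => (t ^+ j / j`!%:R)%:C *
      zsum (fun m => A k m * (e j).2 m)) (2 * (K * L) * a k).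
    move=> j; rewrite Az.
    have -> : 2 * (K * L) * a k * 2^-1 ^+ j = 2 * (K * 2^-1 ^+ j * L) * a k.
      by ring.
    exact: coupling_le (zK j) aL (half j).
  eexists; first exact: zM.
  apply/esym/(@cseries_unique _ _ _ _ (2 * (4 * K * L) * a k) zM) => i.
  under [X in _ - X]eq_bigr do rewrite Az.
  rewrite -(coupling_sum k i aL half zK) -[X in _ - X]mul1r -mulNr.
  have -> : -1 = (-1)%:C :> R[i] by rewrite rmorphN.
  have tail m : normc ((X t).2 m - \sum_(0 <= j < i) z j m) <=
      4 * K * 2^-1 ^+ i * expR (sigma * omega m).
    have -> : 4 * K * 2^-1 ^+ i * expR (sigma * omega m) =
      4 * (K * expR (sigma * omega m)) * 2^-1 ^+ i by ring.
    exact: (cseries_tail i (h m)).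
  have h4 : 0 <= 4 * K * 2^-1 ^+ i by rewrite -mulrA mulr_ge0.
  rewrite -zsum_linear.
  - have -> : 2 * (4 * K * L) * a k * 2^-1 ^+ i =
      2 * (4 * K * 2^-1 ^+ i * L) * a k by ring.
    apply: le_trans (coupling_le k tail aL h4).
    apply: le_of_eq; congr (normc (zsum _)).
    by apply/funext => m; rewrite rmorphN rmorph1; ring.
  - apply: (@coupling_summable k _ (4 * K) _ _ _ aL); last by rewrite mulr_ge0.
    by move=> m; rewrite -mulrA; exact: cseries_le (h m).
  - apply: (@coupling_summable k _ (\sum_(0 <= j < i) K * 2^-1 ^+ j) _ _ _ aL).
      move=> m; elim: i {tail h4} => [|i IH].
        by rewrite !big_geq// mul0r Normc.normc0.
      rewrite !big_nat_recr//= mulrDl; apply: le_trans (normcD _ _) _.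
      by rewrite lerD.
    by rewrite sumr_ge0.
exists X; split.
- by rewrite [RHS]surjective_pairing; congr pair; apply/funext => k;
    rewrite expseries0.
- move=> t k; have [M zM <-] := swap t k.
  have [K [sigma [_ _ /(_ t k (lexx _)) hK]]] := XT `|t|.
  have T0 : 0 < `|t| + 1 by rewrite ltr_wpDl.
  have [K1 h1] := (ent k).1 _ T0; have tT : `|t| <= `|t| + 1 by rewrite lerDl.
  have {}h1 := geometric_le_time tT h1.
  split.
  + suff <- : expseries (fun j => (e j.+1).1 k) t =
        (omega k)%:C * (X t).2 k +
        expseries (fun j => zsum (fun m => A k m * (e j).2 m)) t.
      exact: expseries_cderive (ent k).1.
    rewrite -(cseries_linear _ hK zM); congr cseries; apply/funext => j.
    by rewrite /e /iterates iterS full1 mulrDr mulrCA.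
  + suff <- : expseries (fun j => (e j.+1).2 k) t = - ((omega k)%:C * (X t).1 k).
      exact: expseries_cderive (ent k).2.
    have zero : geometric_le (fun _ => 0 : R[i]) 0.
      by move=> j; rewrite mul0r Normc.normc0.
    have e0 : cseries (fun _ => 0 : R[i]) = 0.
      apply/esym/(cseries_unique (C := 0) zero) => i.
      by rewrite big1// subr0 mul0r Normc.normc0.
    rewrite -[RHS]addr0 -e0 -mulNr -rmorphN -(cseries_linear _ h1 zero).
    congr cseries; apply/funext => j.
    by rewrite /e /iterates iterS full2 addr0 rmorphN mulNr mulrN mulrCA.
- move=> T; have [K [sigma [K0 sg0 h]]] := XT T.
  have [L [L0 _ _ aL]] := profile_sum sigma.
  exists (2 * (4 * K * L)) => t k tT; apply: coupling_le aL _.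
    by move=> m; rewrite -mulrA; apply: cseries_le; exact: h.
  by rewrite mulr_ge0.
Qed.


Lemma profile_sqr_sum : exists L, forall N,
  \sum_(k <- window N) (weight s k * a k) ^+ 2 <= L.
Proof.
have [L [L0 aL _ _]] := profile_sum 0; exists (L ^+ 2 * 3) => N.
apply: (@le_trans _ _ (\sum_(k <- window N) L ^+ 2 * invsq k)).
  apply: ler_sum => k _; have q0 := @invsq_gt0 R k; have q1 := @invsq_le1 R k.
  apply: (@le_trans _ _ ((L * invsq k) ^+ 2)).
    have := aL k; rewrite mul0r expR0 mulr1 => h.
    rewrite ler_sqr ?nnegrE// mulr_ge0//; [exact/ltW/weight_gt0|exact: ltW].
  by rewrite exprMn ler_wpM2l ?sqr_ge0// expr2 ger_pMl.
by rewrite -mulr_sumr ler_wpM2l ?sqr_ge0// sum_invsq.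
Qed.

(** * Trajectories and flows *)

(** This form covers [S1], [S2] and their sum, so that the trajectories of all
    three are obtained from the same lemma. *)
Definition acts_as (S : state R -> state R) (om : int -> R)
    (g : state R -> int -> R[i]) :=
  forall x k, (S x).1 k = (om k)%:C * x.2 k + g x k /\
              (S x).2 k = - ((om k)%:C * x.1 k).

Lemma trajectory_driven S om g X : acts_as S om g -> is_trajectory s S X ->
  driven om (fun t => g (X t)) X.
Proof.
move=> Sg [_ _ dX] t k; have [d1 d2 d3 d4] := dX t k.
have [<- <-] := Sg (X t) k; by [].
Qed.

Lemma driven_trajectory S om g X : acts_as S om g ->
    driven om (fun t => g (X t)) X -> hs s (X 0) ->
    (forall T, exists B, forall t k, `|t| <= T -> normc (g (X t) k) <= B * a k) ->
  is_trajectory s S X.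
Proof.
move=> Sg dX hX gB; have [L aL] := profile_sqr_sum.
have [h1 h2] := driven_continuous dX hX aL gB; split=> // t k.
have [-> ->] := Sg (X t) k; have [[d1 d2] [d3 d4]] := dX t k.
by split.
Qed.

(** Once some trajectory exists, the flow is the value of one of them, though
    perhaps of another one. *)
Lemma flow_trajectory S x t Z : is_trajectory s S Z -> Z 0 = x ->
  exists X, [/\ is_trajectory s S X, X 0 = x & flow s S t x = X t].
Proof.
move=> tZ Z0.
pose P := [set y | exists X, [/\ is_trajectory s S X, X 0 = x & X t = y]].
have [X [tX X0 Xt]] : P (flow s S t x) by apply: xgetPex; exists (Z t), Z.
by exists X.
Qed.

Let force x k := zsum (fun m => A k m * x.2 m).

Lemma skew_acts : acts_as skew omega (fun _ _ => 0).
Proof. by move=> x k; rewrite addr0. Qed.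

Lemma coupling_acts : acts_as coupling (fun _ => 0) force.
Proof. by move=> x k; rewrite !mul0r add0r oppr0. Qed.

Lemma full_acts : acts_as (skew \+ coupling) omega force.
Proof. by move=> x k; rewrite full1 full2. Qed.

Lemma flow_skew x t : hs s x -> flow s skew t x = rotation omega t x.
Proof.
move=> hx; have trot : is_trajectory s skew (rotation omega ^~ x).
  apply: (driven_trajectory skew_acts); first exact: rotation_driven.
    by rewrite rotation0.
  by move=> T; exists 0 => u k _; rewrite mul0r Normc.normc0.
have [X [tX X0 ->]] := flow_trajectory t trot (rotation0 omega x).
by rewrite (driven0_rot (trajectory_driven skew_acts tX)) X0.
Qed.

Lemma hs_rotation x t : hs s x -> hs s (rotation omega t x).
Proof.
by move=> /hs_normP[n [_ _ xn]]; apply: (@hs_energy _ _ _ (n ^+ 2)) => N;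
  rewrite energy_rot.
Qed.

Lemma hs_coord x : hs s x -> exists n, [/\ 0 <= n, norm_hs s x = n%:E &
  forall k, normc (x.1 k) <= n /\ normc (x.2 k) <= n].
Proof.
move=> /hs_normP[n [n0 xn xE]]; exists n; split=> // k.
exact: energy_coord xE k.
Qed.

Lemma force_le x n : 0 <= n -> (forall k, normc (x.2 k) <= n) ->
  exists B, forall k, normc (force x k) <= B * a k.
Proof.
move=> n0 xn; have [L [_ _ _ aL]] := profile_sum 0.
exists (2 * (n * L)) => k; apply: coupling_le aL n0 => m.
by rewrite mul0r expR0 mulr1.
Qed.

(** The coupling is nilpotent of order two, hence its flow is affine. *)
Lemma flow_coupling x t : hs s x ->
  let y := (fun k => x.1 k + t%:C * force x k, x.2) in
  flow s coupling t x = y /\ hs s y.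
Proof.
move=> hx; pose Z r : state R := (fun k => x.1 k + r%:C * force x k, x.2).
have Z0 : Z 0 = x.
  rewrite [RHS]surjective_pairing; congr pair; apply/funext => k.
  by rewrite mul0r addr0.
have tZ : is_trajectory s coupling Z.
  apply: (driven_trajectory coupling_acts); last 2 first.
  - by rewrite Z0.
  - move=> T; have [n [n0 _ xn]] := hs_coord hx.
    have [B xB] := force_le n0 (fun k => (xn k).2).
    by exists B => r k _; exact: xB.
  move=> r k; rewrite !mul0r oppr0 add0r; split; split; rewrite /=.
  - under eq_fun do rewrite ReD ReZ.
    by apply: is_derive_eq; rewrite /GRing.scale/=; ring.
  - under eq_fun do rewrite ImD ImZ.
    by apply: is_derive_eq; rewrite /GRing.scale/=; ring.
  - exact: is_derive_cst.
  - exact: is_derive_cst.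
split; last by case: tZ => hZ _ _; exact: hZ.
have [X [tX X0 ->]] := flow_trajectory t tZ Z0.
have dX := trajectory_driven coupling_acts tX.
have X2 r : (X r).2 = x.2.
  apply/funext => k; rewrite -X0.
  rewrite (@cderive_affine _ (fun r => (X r).2 k) 0 r) ?mulr0 ?addr0// => q.
  by have := (dX q k).2; rewrite mul0r oppr0.
rewrite [LHS]surjective_pairing X2; congr pair; apply/funext => k.
rewrite -[in RHS]X0; apply: (@cderive_affine _ (fun r => (X r).1 k)) => q.
by have := (dX q k).1; rewrite mul0r add0r /force X2 X0.
Qed.

Lemma flow_full x t : hs s x -> exists X,
  [/\ is_trajectory s (skew \+ coupling) X, X 0 = x &
      flow s (skew \+ coupling) t x = X t].
Proof.
move=> hx; have [n [n0 _ xn]] := hs_coord hx.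
have [Z [Z0 dZ gZ]] := coupled_solution n0 xn.
apply: (@flow_trajectory _ _ _ Z) => //.
by apply: (driven_trajectory full_acts); rewrite ?Z0.
Qed.

(** The norm dominates all modes at once, so continuity gives local bounds
    that are uniform in the modes, and compactness a global one. *)
Lemma trajectory_bounded S X T : is_trajectory s S X ->
  exists U, forall t k, `|t| <= T ->
    normc ((X t).1 k) <= U /\ normc ((X t).2 k) <= U.
Proof.
move=> [hX cX _].
pose P (i : nat) (t : R) := forall k,
  normc ((X t).1 k) <= i%:R /\ normc ((X t).2 k) <= i%:R.
have /compact_near_coveringP cov := @segment_compact R (- T) T.
have [|i _ iP] := cov nat \oo P _.
  move=> t _; have [n [n0 _ xn]] := hs_coord (hX t).
  have near1 : \forall r \near t, (norm_hs s (X r - X t)%R <= 1)%E.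
    have /fine_cvgP[fin_near /cvgrPdist_le/(_ _ ltr01)] := cX t.
    apply: filterS2 fin_near => r fr; rewrite /= sub0r normrN => h.
    by rewrite -(fineK fr) lee_fin (le_trans (ler_norm _)).
  exists ([set r | (norm_hs s (X r - X t)%R <= 1)%E], [set i | n + 1 <= i%:R]).
    split=> //=; exists (Num.truncn (n + 1)).+1 => // i /= ni.
    apply: le_trans (ltW (truncnS_gt _)) _; rewrite ler_nat; exact: ni.
  move=> [r i] /= [h ni] k; have [x1 x2] := xn k.
  have /(_ k)[d1 d2] := energy_coord s_ge0 ler01 ((norm_hs_leP s _ ler01).1 h).
  have split_z (z w : R[i]) : normc (z - w) <= 1 -> normc w <= n -> normc z <= i%:R.
    move=> h1 h2; rewrite -(subrK w z); apply: le_trans (normcD _ _) _.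
    by apply: le_trans ni; rewrite addrC lerD.
  by split; [exact: split_z d1 x1|exact: split_z d2 x2].
exists i%:R => t k tT; apply: (iP i (leqnn i)).
by rewrite /= in_itv/= -ler_norml.
Qed.

(** For short times the bound by the initial datum does not depend on the
    trajectory: a finite bound [U] improves itself to [2 n + U / 2]. *)
Lemma trajectory_apriori X n L t0 : is_trajectory s (skew \+ coupling) X ->
    0 <= n -> (forall k, normc ((X 0).1 k) <= n /\ normc ((X 0).2 k) <= n) ->
    0 <= L -> (forall k, a k <= L) ->
    (forall N, \sum_(k <- window N) a k <= L) ->
    0 <= t0 -> 16 * L ^+ 2 * t0 <= 1 ->
  forall t k, `|t| <= t0 ->
    normc ((X t).1 k) <= 4 * n /\ normc ((X t).2 k) <= 4 * n.
Proof.
move=> tX n0 xn L0 aL1 aL t00 t0L.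
have dX := trajectory_driven full_acts tX.
have [U0 XU0] := trajectory_bounded t0 tX.
pose V := [set y : R | exists t k, `|t| <= t0 /\
  (y = normc ((X t).1 k) \/ y = normc ((X t).2 k))].
have V_sup : has_sup V.
  split; first by exists (normc ((X 0).1 0)), 0, 0; rewrite normr0; split=> //; left.
  exists U0 => _ [t [k [tt0 [->|->]]]]; have [] := XU0 t k tt0; by [].
pose U := sup V; have XU t k : `|t| <= t0 ->
    normc ((X t).1 k) <= U /\ normc ((X t).2 k) <= U.
  by move=> tt0; split; apply: (ub_le_sup V_sup.2); exists t, k; split=> //;
    [left|right].
have U_ge0 : 0 <= U.
  by apply: le_trans (XU 0 0 _).1; rewrite ?normc_ge0// normr0.
have forceU t k : `|t| <= t0 -> normc (force (X t) k) <= 2 * (U * L) * a k.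
  move=> tt0; apply: (@coupling_le k _ U (fun=> 1)) => // [m|N].
    by rewrite mulr1; exact: (XU t m tt0).2.
  by under eq_bigr do rewrite mulr1.
have improve t k : `|t| <= t0 ->
    normc ((X t).1 k) <= 2 * n + U / 2 /\ normc ((X t).2 k) <= 2 * n + U / 2.
  move=> tt0; have [h1 h2] := driven_profile dX forceU k tt0.
  set y := rotation omega (- t) (X t) in h1 h2.
  have -> : X t = rotation omega t y by rewrite -rotationD subrr rotation0.
  have bnd (z w : R[i]) : normc (z - w) <= 2 * (2 * (U * L) * a k) * t0 ->
      normc w <= n -> normc z <= n + U / 4.
    move=> zw wn; rewrite -(subrK w z) addrC; apply: le_trans (normcD _ _) _.
    apply: lerD => //; apply: le_trans zw _.
    have ka := aL1 k; have ULt : 0 <= U * L * t0 by rewrite !mulr_ge0.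
    have -> : 2 * (2 * (U * L) * a k) * t0 = 4 * (U * L * t0) * a k by ring.
    apply: le_trans (_ : 4 * (U * L * t0) * L <= _); last by nra.
    by rewrite ler_wpM2l// mulr_ge0.
  have y1 := bnd _ _ h1 (xn k).1; have y2 := bnd _ _ h2 (xn k).2.
  have comb (c d : R) (z w : R[i]) : `|c| <= 1 -> `|d| <= 1 ->
      normc z <= n + U / 4 -> normc w <= n + U / 4 ->
      normc (c%:C * z) + normc (d%:C * w) <= 2 * n + U / 2.
    move=> c1 d1 zn wn; rewrite !normcZ.
    have := ler_wpM2r (normc_ge0 z) c1; have := ler_wpM2r (normc_ge0 w) d1.
    by rewrite !mul1r; lra.
  have cos1 : `|cos (omega k * t)| <= 1 by rewrite ler_norml cos_geN1 cos_le1.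
  have sin1 : `|sin (omega k * t)| <= 1 by rewrite ler_norml sin_geN1 sin_le1.
  split.
    by apply: le_trans (normcD _ _) _; exact: comb.
  by apply: le_trans (normcB _ _) _; exact: comb.
have U_le : U <= 2 * n + U / 2.
  apply: ge_sup; first exact: V_sup.1.
  by move=> _ [t [k [tt0 [->|->]]]]; have [] := improve t k tt0.
move=> t k tt0; have [] := XU t k tt0; lra.
Qed.


(** * Local errors of the splittings *)

Lemma frequency_le_exp k (E := expR (2 * omega k)) :
  [/\ 1 <= E, omega k <= E & omega k ^+ 2 <= E].
Proof.
have EE : E = expR (omega k) ^+ 2 by rewrite -expRM_natl.
have w0 := omega_ge0 k; have := expR_ge1Dx (omega k).
by rewrite EE; move: (expR _) => y; split; nra.
Qed.

(** The equation is integrated twice in each mode; this costs two factors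
    [omega k], which the exponential weight absorbs. *)
Lemma trajectory_expansion X U L t k : driven omega (fun t => force (X t)) X ->
    0 <= U -> 0 <= L -> a k <= L -> (forall N, \sum_(m <- window N) a m <= L) ->
    (forall r m, `|r| <= `|t| ->
       normc ((X r).1 m) <= U /\ normc ((X r).2 m) <= U) ->
  normc ((X t).2 k - (X 0).2 k - t%:C * - ((omega k)%:C * (X 0).1 k)) <=
    4 * (1 + 2 * L ^+ 2) * U * expR (2 * omega k) * t ^+ 2 /\
  normc ((X t).2 k - (X 0).2 k) <= 2 * U * expR (2 * omega k) * `|t|.
Proof.
move=> dX U0 L0 akL aL XU; have w0 := omega_ge0 k.
have [E1 wE w2E] := frequency_le_exp k; set E := expR _ in E1 wE w2E *.
have t2 : `|t| * `|t| = t ^+ 2 by rewrite -expr2 real_normK ?num_real.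
have rot_le r : `|r| <= `|t| -> normc (- ((omega k)%:C * (X r).1 k)) <= omega k * U.
  move=> rt; rewrite normcN normcZ ger0_norm// ler_wpM2l//.
  exact: (XU r k rt).1.
split; last first.
  apply: le_trans (cderive_lipschitz (fun r => (dX r k).2) rot_le) _.
  by rewrite ler_wpM2r// -!mulrA ler_wpM2l// mulrC ler_wpM2l.
have dxi r : `|r| <= `|t| ->
    normc ((X r).1 k - (X 0).1 k) <= 2 * (omega k * U + 2 * U * L ^+ 2) * `|r|.
  move=> rt; apply: cderive_lipschitz (fun q => (dX q k).1) _ => q qr.
  have qt := le_trans qr rt; apply: le_trans (normcD _ _) _; apply: lerD.
    by rewrite normcZ ger0_norm// ler_wpM2l//; exact: (XU q k qt).2.
  apply: le_trans (@coupling_le k _ U (fun=> 1) L _ _ U0) _.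
  - by move=> m; rewrite mulr1; exact: (XU q m qt).2.
  - by move=> N; under eq_bigr do rewrite mulr1.
  - have -> : 2 * (U * L) * a k = 2 * U * (L * a k) by ring.
    by rewrite ler_wpM2l ?mulr_ge0// expr2 ler_wpM2l.
pose K := omega k * (2 * (omega k * U + 2 * U * L ^+ 2) * `|t|).
have := @cderive_taylor2 _ (fun r => (X r).2 k) _
  (- ((omega k)%:C * (X 0).1 k)) 0 K t (fun r => (dX r k).2).
rewrite mulr0 subr0 => h; apply: le_trans (h _) _.
  move=> r rt; rewrite mulr0 subr0.
  have -> : - ((omega k)%:C * (X r).1 k) - - ((omega k)%:C * (X 0).1 k) =
    - ((omega k)%:C * ((X r).1 k - (X 0).1 k)) by ring.
  rewrite normcN normcZ ger0_norm// ler_wpM2l//; apply: le_trans (dxi r rt) _.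
  by rewrite ler_wpM2l// mulr_ge0// addr_ge0 ?mulr_ge0 ?sqr_ge0.
have -> : 2 * K * `|t| =
    4 * U * t ^+ 2 * (omega k ^+ 2 + 2 * L ^+ 2 * omega k).
  by rewrite -t2 /K; ring.
have -> : 4 * (1 + 2 * L ^+ 2) * U * E * t ^+ 2 =
  4 * U * t ^+ 2 * (E + 2 * L ^+ 2 * E) by ring.
have c0 : 0 <= 4 * U * t ^+ 2 by rewrite mulr_ge0 ?sqr_ge0// mulr_ge0.
have L2 : 0 <= 2 * L ^+ 2 by rewrite mulr_ge0 ?sqr_ge0.
by rewrite (ler_wpM2l c0)// lerD// ler_wpM2l.
Qed.

(** The derivative of the force at time zero, along the full trajectory and
    along the free rotation alike: the coupling reads the second component,
    on which only the rotation acts. *)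
Let force' x k := zsum (fun m => A k m * - ((omega m)%:C * x.1 m)).

(** The expansion of [u] is summed against the coupling.  It is applied to
    the full trajectory at time [r] and to the free rotation at half the time
    step. *)
Lemma force_expansion x (u : int -> R[i]) c L r k : 0 <= c ->
    (forall N, \sum_(m <- window N) a m * expR (2 * omega m) <= L) ->
    (forall m, normc (x.1 m) <= c /\ normc (x.2 m) <= c) ->
    (forall m, normc (u m - x.2 m - r%:C * - ((omega m)%:C * x.1 m)) <=
       c * expR (2 * omega m) * r ^+ 2) ->
    (forall m, normc (u m - x.2 m) <= c * expR (2 * omega m) * `|r|) ->
    (forall m, normc (u m) <= c) ->
  let h := zsum (fun m => A k m * u m) in let B := 2 * (c * L) * a k in
  [/\ normc (h - force x k - r%:C * force' x k) <= B * r ^+ 2,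
      normc (h - force x k) <= B * `|r| & normc h <= B].
Proof.
move=> c0 aL xc u2 u1 u0 h B.
have E1 m : 1 <= expR (2 * omega m) by have [] := frequency_le_exp m.
have cE m z : normc z <= c -> normc z <= c * expR (2 * omega m).
  by move=> /le_trans; apply; rewrite ler_peMr.
have su : abs_summable (fun m => A k m * u m).
  by apply: coupling_summable aL c0 => m; exact: cE.
have sx : abs_summable (fun m => A k m * x.2 m).
  by apply: coupling_summable aL c0 => m; apply: cE; exact: (xc m).2.
have sx' : abs_summable (fun m => A k m * - ((omega m)%:C * x.1 m)).
  apply: coupling_summable aL c0 => m; rewrite normcN normcZ ger0_norm// mulrC.
  by have [_ wE _] := frequency_le_exp m; rewrite ler_pM ?normc_ge0// (xc m).1.
have m1 : -1 = (-1)%:C :> R[i] by rewrite rmorphN.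
have hx : h - force x k = zsum (fun m => A k m * (u m - x.2 m)).
  rewrite -[force x k]mul1r -mulNr m1 -zsum_linear//; congr zsum.
  by apply/funext => m; rewrite rmorphN rmorph1; ring.
split.
- rewrite hx -mulNr -rmorphN -zsum_linear//; last first.
    apply: (coupling_summable k _ aL (mulr_ge0 c0 (normr_ge0 r))) => m.
    by rewrite mulrAC; exact: u1.
  have -> : B * r ^+ 2 = 2 * (c * r ^+ 2 * L) * a k by rewrite /B; ring.
  have c2 : 0 <= c * r ^+ 2 by rewrite mulr_ge0 ?sqr_ge0.
  rewrite (_ : (fun m => _) = (fun m =>
    A k m * (u m - x.2 m - r%:C * - ((omega m)%:C * x.1 m)))); last first.
    by apply/funext => m; rewrite rmorphN; ring.
  by apply: (coupling_le _ _ aL c2) => m; rewrite mulrAC; exact: u2.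
- have -> : B * `|r| = 2 * (c * `|r| * L) * a k by rewrite /B; ring.
  rewrite hx; apply: (coupling_le _ _ aL (mulr_ge0 c0 (normr_ge0 r))) => m.
  by rewrite mulrAC; exact: u1.
- by apply: (coupling_le _ _ aL c0) => m; exact: cE.
Qed.


(** The cosine is [1] to second order and does not change the expansion; the
    sine is [w r] to second order and only sees the leading coefficient. *)
Lemma modulated_expansion (w r E B : R) (h g0 g1 : R[i]) :
    0 <= w -> 1 <= E -> w <= E -> w ^+ 2 <= E ->
    normc (h - g0 - r%:C * g1) <= B * r ^+ 2 -> normc (h - g0) <= B * `|r| ->
    normc h <= B ->
  normc ((cos (w * r))%:C * h - g0 - r%:C * g1) <= 2 * B * E * r ^+ 2 /\
  normc ((sin (w * r))%:C * h - r%:C * (w%:C * g0)) <= 2 * B * E * r ^+ 2.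
Proof.
move=> w0 E1 wE w2E h2 h1 h0.
have B0 : 0 <= B by exact: le_trans (normc_ge0 h) h0.
have r20 := sqr_ge0 r; have Br : 0 <= B * r ^+ 2 by rewrite mulr_ge0.
have wr2 (y : R) : `|y| <= (w * r) ^+ 2 -> `|y| * normc h <= B * r ^+ 2 * E.
  move=> yw; apply: le_trans (ler_pM (normr_ge0 y) (normc_ge0 h) yw h0) _.
  have -> : (w * r) ^+ 2 * B = B * r ^+ 2 * w ^+ 2 by rewrite exprMn; ring.
  by rewrite ler_wpM2l.
have -> : 2 * B * E * r ^+ 2 = B * r ^+ 2 * E + B * r ^+ 2 * E by ring.
split.
- have -> : (cos (w * r))%:C * h - g0 - r%:C * g1 =
      (cos (w * r) - 1)%:C * h + (h - g0 - r%:C * g1).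
    by rewrite rmorphB rmorph1; ring.
  apply: le_trans (normcD _ _) _; apply: lerD.
    by rewrite normcZ wr2// cos_sub1_le.
  by apply: le_trans h2 _; rewrite ler_peMr.
- have -> : (sin (w * r))%:C * h - r%:C * (w%:C * g0) =
      (sin (w * r) - w * r)%:C * h + (w * r)%:C * (h - g0).
    by rewrite rmorphB rmorphM/=; ring.
  apply: le_trans (normcD _ _) _; apply: lerD.
    by rewrite normcZ wr2// sin_sub_id_le.
  rewrite normcZ normrM (ger0_norm w0) -[w * _ * _]mulrA.
  apply: le_trans (ler_wpM2l w0 (ler_wpM2l (normr_ge0 r) h1)) _.
  have -> : `|r| * (B * `|r|) = B * r ^+ 2.
    by rewrite mulrCA -expr2 real_normK ?num_real.
  by rewrite mulrC ler_wpM2l.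
Qed.

(** In the rotating frame the velocity is the modulated force, whose expansion
    to first order is integrated.  The coefficients of [t^2 / 2] contain no
    square of the coupling, since it is nilpotent. *)
Lemma rotating_frame_expansion X c L t k :
    driven omega (fun t => force (X t)) X ->
    0 <= c -> (forall N, \sum_(m <- window N) a m * expR (2 * omega m) <= L) ->
    (forall m, normc ((X 0).1 m) <= c /\ normc ((X 0).2 m) <= c) ->
    (forall r m, `|r| <= `|t| ->
      [/\ normc ((X r).2 m - (X 0).2 m - r%:C * - ((omega m)%:C * (X 0).1 m)) <=
            c * expR (2 * omega m) * r ^+ 2,
          normc ((X r).2 m - (X 0).2 m) <= c * expR (2 * omega m) * `|r| &
          normc ((X r).2 m) <= c]) ->
  let K := 8 * (c * L) * a k * expR (2 * omega k) * `|t| ^+ 3 in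
  let y := rotation omega (- t) (X t) in
  normc (y.1 k - (X 0).1 k - t%:C * force (X 0) k -
         (t ^+ 2 / 2)%:C * force' (X 0) k) <= K /\
  normc (y.2 k - (X 0).2 k - (t ^+ 2 / 2)%:C * ((omega k)%:C * force (X 0) k))
    <= K.
Proof.
move=> dX c0 aL xc Xc K y; pose B := 2 * (c * L) * a k.
pose E := expR (2 * omega k); have [E1 wE w2E] := frequency_le_exp k.
have mod r : `|r| <= `|t| ->
    normc ((cos (omega k * r))%:C * force (X r) k - force (X 0) k -
      r%:C * force' (X 0) k) <= 2 * B * E * t ^+ 2 /\
    normc ((sin (omega k * r))%:C * force (X r) k -
      r%:C * ((omega k)%:C * force (X 0) k)) <= 2 * B * E * t ^+ 2.
  move=> rt; have [h2 h1 h0] := @force_expansion (X 0) (fun m => (X r).2 m) c L r k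
    c0 aL xc (fun m => let: And3 p _ _ := Xc r m rt in p)
    (fun m => let: And3 _ p _ := Xc r m rt in p)
    (fun m => let: And3 _ _ p := Xc r m rt in p).
  have [m1 m2] := modulated_expansion (omega_ge0 k) E1 wE w2E h2 h1 h0.
  have B0 : 0 <= B by exact: le_trans (normc_ge0 _) h0.
  have rt2 : 2 * B * E * r ^+ 2 <= 2 * B * E * t ^+ 2.
    apply: ler_wpM2l; first by apply: mulr_ge0 (expR_ge0 _); exact: mulr_ge0.
    rewrite -[r ^+ 2]real_normK ?num_real// -[t ^+ 2]real_normK ?num_real//.
    by rewrite lerXn2r ?nnegrE.
  by split; [apply: le_trans m1 rt2|apply: le_trans m2 rt2].
have KE : K = 2 * (2 * B * E * t ^+ 2) * `|t|.
  have t3 : `|t| ^+ 3 = `|t| * t ^+ 2 by rewrite exprS real_normK ?num_real.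
  by rewrite /K /B /E t3; ring.
have X0 : X 0 = rotation omega (- 0) (X 0) by rewrite oppr0 rotation0.
have drX := driven_rot dX.
split.
- rewrite [X in normc (_ - X.1 k - _ - _)]X0 KE.
  apply: cderive_taylor2 (fun r => (drX r k).1) _ => r rt.
  exact: (mod r rt).1.
- have := @cderive_taylor2 _ (fun r => (rotation omega (- r) (X r)).2 k) _ 0
    ((omega k)%:C * force (X 0) k) _ t (fun r => (drX r k).2).
  rewrite mulr0 subr0 -X0 KE; apply => r rt.
  by rewrite subr0; exact: (mod r rt).2.
Qed.

(** The decay of the profile pays for the weight of [h^s] and for the
    summation over the modes. *)
Lemma norm_hs_profile x L M : 0 <= L -> 0 <= M ->
    (forall k, weight s k * a k * expR (2 * omega k) <= L * invsq k) ->
    (forall k, normc (x.1 k) <= M * a k * expR (2 * omega k) /\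
               normc (x.2 k) <= M * a k * expR (2 * omega k)) ->
  (norm_hs s x <= (3 * M * L)%:E)%E.
Proof.
move=> L0 M0 aL xM; apply/norm_hs_leP; first by rewrite !mulr_ge0.
move=> N; apply: (@le_trans _ _ (\sum_(k <- window N) 2 * (M * L) ^+ 2 * invsq k)).
  apply: ler_sum => k _; have q0 := @invsq_gt0 R k; have q1 := @invsq_le1 R k.
  have w0 := weight_gt0 s k.
  have sq (z : R[i]) : normc z <= M * a k * expR (2 * omega k) ->
      weight s k ^+ 2 * normc z ^+ 2 <= (M * L) ^+ 2 * invsq k.
    move=> zM; rewrite -exprMn; apply: (@le_trans _ _ ((M * L * invsq k) ^+ 2)).
      rewrite ler_sqr ?nnegrE ?(mulr_ge0 (ltW w0)) ?normc_ge0//; last first.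
        by rewrite !mulr_ge0// ltW.
      apply: le_trans (ler_wpM2l (ltW w0) zM) _; rewrite -(mulrA M L).
      apply: le_trans (ler_wpM2l M0 (aL k)).
      by apply: le_of_eq; ring.
    by rewrite exprMn ler_wpM2l ?sqr_ge0// expr2 ger_pMl.
  rewrite mulrDr; have := lerD (sq _ (xM k).1) (sq _ (xM k).2).
  by move=> /le_trans; apply; rewrite -mulr2n -mulrA mulr_natl.
rewrite -mulr_sumr; apply: le_trans (ler_wpM2l _ (sum_invsq N)) _.
  by rewrite mulr_ge0 ?sqr_ge0.
have -> : (3 * M * L) ^+ 2 = 9 * (M * L) ^+ 2 by ring.
have := sqr_ge0 (M * L); lra.
Qed.

Lemma force_coeff_le x c L k : 0 <= c ->
    (forall N, \sum_(m <- window N) a m * expR (2 * omega m) <= L) ->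
    (forall m, normc (x.1 m) <= c /\ normc (x.2 m) <= c) ->
  normc (force x k) <= 2 * (c * L) * a k /\
  normc (force' x k) <= 2 * (c * L) * a k.
Proof.
move=> c0 aL xc; split; apply: (coupling_le _ _ aL c0) => m.
  have [E1 _ _] := frequency_le_exp m.
  by apply: le_trans (xc m).2 _; rewrite ler_peMr.
have [_ wE _] := frequency_le_exp m; rewrite normcN normcZ ger0_norm// mulrC.
by rewrite ler_pM ?normc_ge0// (xc m).1.
Qed.

Lemma norm_hs_rotation t x : norm_hs s (rotation omega t x) = norm_hs s x.
Proof.
by rewrite !norm_hsE; congr sqrte; apply: eq_esum => k _; rewrite rotation_modulus.
Qed.

(** Both errors are rotated into the frame of the expansion, where the
    splitting is the explicit affine function of the step that matches the
    Taylor coefficients of the solution to first, resp. second, order. *)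
Theorem splitting_error : exists C tau0 : R, [/\ 0 < C, 0 < tau0 &
  forall (x : state R) (tau : R), hs s x -> `|tau| <= tau0 ->
    (norm_hs s (flow s skew tau (flow s coupling tau x)
                - flow s (skew \+ coupling) tau x)%R
       <= (C * tau ^+ 2)%:E * norm_hs s x)%E /\
    (norm_hs s (flow s skew (tau / 2)
                  (flow s coupling tau (flow s skew (tau / 2) x))
                - flow s (skew \+ coupling) tau x)%R
       <= (C * `|tau| ^+ 3)%:E * norm_hs s x)%E].
Proof.
have [L [L0 waL aL1 aL]] := profile_sum 2.
have E1 m : 1 <= expR (2 * omega m) by have [] := frequency_le_exp m.
have akL k : a k <= L by apply: le_trans (aL1 k); rewrite ler_peMr.
have sumaL N : \sum_(k <- window N) a k <= L.
  by apply: le_trans (aL N); apply: ler_sum => k _; rewrite ler_peMr.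
(* The constant of [trajectory_expansion] for the a priori bound [4 n]. *)
pose c0 := 16 * (1 + 2 * L ^+ 2).
have L20 : 0 <= L ^+ 2 by rewrite sqr_ge0.
have c01 : 16 <= c0 by rewrite /c0; lra.
have c00 : 0 <= c0 by apply: le_trans c01.
(* The step size for which the a priori bound closes. *)
pose tau0 := (1 + 16 * L ^+ 2)^-1.
have t00 : 0 < tau0 by rewrite invr_gt0; lra.
have t0L : 16 * L ^+ 2 * tau0 <= 1.
  by rewrite ler_pdivrMr ?mul1r ?lerDr//; lra.
have t01 : tau0 <= 1 by rewrite invf_le1 ?lerDl; lra.
pose C := 3 * (10 * c0 * L) * L + 1.
have C0 : 0 < C.
  by rewrite ltr_wpDl// mulr_ge0// mulr_ge0// mulr_ge0// mulr_ge0.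
exists C, tau0; split=> // x t hx tt0.
have [n [n0 nx xn]] := hs_coord hx.
have t1 : `|t| <= 1 by exact: le_trans tt0 t01.
pose c := c0 * n; have cn0 : 0 <= c by rewrite mulr_ge0.
have nc p : 0 <= p <= 16 -> p * n <= c.
  by move=> /andP[p0 p16]; rewrite /c ler_wpM2r// (le_trans p16).
have xc m : normc (x.1 m) <= c /\ normc (x.2 m) <= c.
  have nc1 : n <= c by rewrite -[n]mul1r nc//; lra.
  by split; apply: le_trans nc1; [exact: (xn m).1|exact: (xn m).2].
have [X [tX X0 ->]] := flow_full t hx.
have dX := trajectory_driven full_acts tX.
have XU r m : `|r| <= `|t| ->
    normc ((X r).1 m) <= 4 * n /\ normc ((X r).2 m) <= 4 * n.
  move=> rt; apply: (trajectory_apriori tX n0 _ L0 akL sumaL (ltW t00) t0L).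
    by rewrite X0.
  exact: le_trans tt0.
have n40 : 0 <= 4 * n by rewrite mulr_ge0.
have XE r m : `|r| <= `|t| ->
    [/\ normc ((X r).2 m - (X 0).2 m - r%:C * - ((omega m)%:C * (X 0).1 m)) <=
          c * expR (2 * omega m) * r ^+ 2,
        normc ((X r).2 m - (X 0).2 m) <= c * expR (2 * omega m) * `|r| &
        normc ((X r).2 m) <= c].
  move=> rt; have [h2 h1] := @trajectory_expansion X (4 * n) L r m dX n40 L0
    (akL m) sumaL (fun q i qr => XU q i (le_trans qr rt)).
  split.
  - apply: le_trans h2 _; apply: le_of_eq.
    by rewrite /c /c0; ring.
  - apply: le_trans h1 _; rewrite ler_wpM2r// ler_wpM2r ?expR_ge0//.
    by rewrite mulrA nc//; lra.
  - by apply: le_trans (XU r m rt).2 _; rewrite nc//; lra.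
pose y := rotation omega (- t) (X t).
have Xy : X t = rotation omega t y by rewrite -rotationD subrr rotation0.
have cL0 : 0 <= c * L by rewrite mulr_ge0.
pose K k := 8 * (c * L) * a k * expR (2 * omega k) * `|t| ^+ 3.
have yE k : normc (y.1 k - x.1 k - t%:C * force x k -
      (t ^+ 2 / 2)%:C * force' x k) <= K k /\
    normc (y.2 k - x.2 k - (t ^+ 2 / 2)%:C * ((omega k)%:C * force x k)) <= K k.
  by rewrite -X0; apply: rotating_frame_expansion => //; rewrite X0.
(* A profile bound in the rotating frame is an estimate of the error. *)
have error_le z del : 0 <= del ->
    (forall k, normc (z.1 k) <= 10 * (c * L) * del * a k * expR (2 * omega k) /\
               normc (z.2 k) <= 10 * (c * L) * del * a k * expR (2 * omega k)) ->
    (norm_hs s (rotation omega t z) <= (C * del)%:E * norm_hs s x)%E.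
  move=> del0 zE; rewrite norm_hs_rotation nx -EFinM.
  apply: le_trans (norm_hs_profile L0 _ waL zE) _.
    by rewrite mulr_ge0// mulr_ge0.
  rewrite lee_fin.
  have -> : C * del * n = 3 * (10 * (c * L) * del) * L + del * n.
    by rewrite /C /c; ring.
  by rewrite lerDl mulr_ge0.
have t20 := sqr_ge0 t; have n3 : 0 <= `|t| ^+ 3 by rewrite exprn_ge0.
have t3 : `|t| ^+ 3 = `|t| * t ^+ 2 by rewrite exprS real_normK ?num_real.
have t32 : `|t| ^+ 3 <= t ^+ 2 by rewrite t3 ler_piMl.
pose Q k := c * L * a k * expR (2 * omega k).
have Q0 k : 0 <= Q k by rewrite mulr_ge0 ?expR_ge0// mulr_ge0.
have KQ k : K k = 8 * Q k * `|t| ^+ 3 by rewrite /K /Q; ring.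
split.
(* Lie: the terms of order [t ^ 2] remain. *)
- have [-> hw] := flow_coupling t hx; rewrite flow_skew// Xy -rotationB.
  apply: error_le => // k; have [y1 y2] := yE k.
  have [f0 f1] := force_coeff_le k cn0 aL xc.
  have [_ wE _] := frequency_le_exp k.
  have BQ : 2 * (c * L) * a k <= 2 * Q k.
    have -> : 2 * Q k = 2 * (c * L) * a k * expR (2 * omega k).
      by rewrite /Q; ring.
    by rewrite ler_peMr// mulr_ge0// mulr_ge0.
  have step (p q : R[i]) : normc (p - (t ^+ 2 / 2)%:C * q) <= K k ->
      normc q <= 2 * Q k ->
      normc (- p) <= 10 * (c * L) * t ^+ 2 * a k * expR (2 * omega k).
    move=> pq qQ; rewrite normcN -(subrK ((t ^+ 2 / 2)%:C * q) p).
    apply: le_trans (normcD _ _) _; rewrite normcZ ger0_norm ?divr_ge0//.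
    have -> : 10 * (c * L) * t ^+ 2 * a k * expR (2 * omega k) =
      10 * Q k * t ^+ 2 by rewrite /Q; ring.
    have h1 := ler_wpM2l (Q0 k) t32.
    have h2 := ler_wpM2l t20 qQ.
    rewrite KQ in pq; have h3 := mulr_ge0 (Q0 k) t20; lra.
  split.
  + have -> : ((fun k => x.1 k + t%:C * force x k, x.2) - y).1 k =
      - (y.1 k - x.1 k - t%:C * force x k) by rewrite /= !fctE; ring.
    by apply: step y1 _; apply: le_trans f1 BQ.
  + have -> : ((fun k => x.1 k + t%:C * force x k, x.2) - y).2 k =
      - (y.2 k - x.2 k) by rewrite /= !fctE; ring.
    apply: step y2 _; rewrite normcZ ger0_norm//.
    apply: le_trans (ler_wpM2l (omega_ge0 k) f0) _.
    have -> : 2 * Q k = expR (2 * omega k) * (2 * (c * L) * a k).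
      by rewrite /Q; ring.
    by rewrite ler_wpM2r// mulr_ge0// mulr_ge0.
(* Strang: the force is evaluated at the rotated datum at time [t / 2], whose
   expansion reproduces the terms of order [t ^ 2]. *)
- pose x' := rotation omega (t / 2) x; have hx' := hs_rotation (t / 2) hx.
  rewrite (flow_skew (t / 2) hx); have [-> hw] := flow_coupling t hx'.
  rewrite flow_skew// Xy; rewrite -/x' in hw *.
  pose d : state R := (fun k => - (t%:C * force x' k), 0).
  have -> : (fun k => x'.1 k + t%:C * force x' k, x'.2) = x' - d.
    rewrite [x' - d]surjective_pairing /=; congr pair.
      by apply/funext => k; rewrite !fctE opprK.
    by rewrite subr0.
  have -> : rotation omega (t / 2) (x' - d) - rotation omega t y =
      rotation omega t (x - rotation omega (- (t / 2)) d - y).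
    rewrite !rotationB -!rotationD.
    have -> : t - t / 2 = t / 2 by field.
    by rewrite -splitr.
  apply: error_le => // k.
  have ux (m : int) (v := omega m * (t / 2)) : [/\
      normc (x'.2 m - x.2 m - (t / 2)%:C * - ((omega m)%:C * x.1 m)) <=
        c * expR (2 * omega m) * (t / 2) ^+ 2,
      normc (x'.2 m - x.2 m) <= c * expR (2 * omega m) * `|t / 2| &
      normc (x'.2 m) <= c].
    have [xi1 xi2] := xn m; have [_ wE w2E] := frequency_le_exp m.
    have cn : 2 * n <= c by rewrite nc//; lra.
    have v2 : v ^+ 2 <= expR (2 * omega m) * (t / 2) ^+ 2.
      by rewrite exprMn ler_wpM2r ?sqr_ge0.
    have v1 : `|v| <= expR (2 * omega m) * `|t / 2|.
      by rewrite normrM ger0_norm// ler_wpM2r.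
    have comb (p q V : R) : `|p| <= V -> `|q| <= V ->
        normc (p%:C * x.2 m - q%:C * x.1 m) <= c * V.
      move=> pV qV; apply: le_trans (normcB _ _) _; rewrite !normcZ.
      have h1 := ler_pM (normr_ge0 p) (normc_ge0 (x.2 m)) pV xi2.
      have h2 := ler_pM (normr_ge0 q) (normc_ge0 (x.1 m)) qV xi1.
      have V0 : 0 <= V by exact: le_trans (normr_ge0 p) pV.
      have := ler_wpM2r V0 cn; lra.
    split.
    - rewrite -[c * _ * _]mulrA.
      have -> : x'.2 m - x.2 m - (t / 2)%:C * - ((omega m)%:C * x.1 m) =
          (cos v - 1)%:C * x.2 m - (sin v - v)%:C * x.1 m.
        by rewrite /x' /= -/v !rmorphB rmorph1 /v rmorphM/=; ring.
      apply: comb; apply: le_trans v2; [exact: cos_sub1_le|exact: sin_sub_id_le].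
    - rewrite -[c * _ * _]mulrA.
      have -> : x'.2 m - x.2 m = (cos v - 1)%:C * x.2 m - (sin v)%:C * x.1 m.
        by rewrite /x' /= -/v rmorphB rmorph1; ring.
      apply: comb; apply: le_trans v1; [exact: cos_lipschitz|exact: sin_lipschitz].
    - rewrite -[c]mulr1; apply: comb; rewrite ler_norml.
        by rewrite cos_geN1 cos_le1.
      by rewrite sin_geN1 sin_le1.
  have [h2 h1 h0] := force_expansion k cn0 aL xc
    (fun m => let: And3 p _ _ := ux m in p)
    (fun m => let: And3 _ p _ := ux m in p)
    (fun m => let: And3 _ _ p := ux m in p).
  have [_ wE w2E] := frequency_le_exp k.
  have [m1 m2] := modulated_expansion (omega_ge0 k) (E1 k) wE w2E h2 h1 h0.
  rewrite -/(force x' k) in m1 m2; set h := force x' k in m1 m2.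
  have [y1 y2] := yE k.
  have BQ : 2 * (2 * (c * L) * a k) * expR (2 * omega k) * (t / 2) ^+ 2 =
    Q k * t ^+ 2 by rewrite /Q; field.
  rewrite BQ in m1 m2; rewrite KQ in y1 y2.
  have step (p q : R[i]) : normc p <= Q k * t ^+ 2 ->
      normc q <= 8 * Q k * `|t| ^+ 3 ->
      normc (t%:C * p - q) <=
        10 * (c * L) * `|t| ^+ 3 * a k * expR (2 * omega k).
    move=> pQ qQ; apply: le_trans (normcB _ _) _; rewrite normcZ.
    have -> : 10 * (c * L) * `|t| ^+ 3 * a k * expR (2 * omega k) =
      10 * Q k * `|t| ^+ 3 by rewrite /Q; ring.
    have := ler_wpM2l (normr_ge0 t) pQ; rewrite mulrCA -t3.
    have := mulr_ge0 (Q0 k) n3; lra.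
  have tt2 : (t ^+ 2 / 2)%:C = t%:C * (t / 2)%:C :> R[i].
    by rewrite -rmorphM; congr (_%:C); ring.
  split.
  + have -> : (x - rotation omega (- (t / 2)) d - y).1 k =
        t%:C * ((cos (omega k * (t / 2)))%:C * h - force x k -
          (t / 2)%:C * force' x k) -
        (y.1 k - x.1 k - t%:C * force x k - (t ^+ 2 / 2)%:C * force' x k).
      by rewrite /= !fctE -/h [omega k * - _]mulrN cosN tt2; ring.
    exact: step.
  + have -> : (x - rotation omega (- (t / 2)) d - y).2 k =
        t%:C * ((sin (omega k * (t / 2)))%:C * h -
          (t / 2)%:C * ((omega k)%:C * force x k)) -
        (y.2 k - x.2 k - (t ^+ 2 / 2)%:C * ((omega k)%:C * force x k)).
      rewrite /= !fctE -/h [omega k * - _]mulrN sinN rmorphN tt2; ring.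
    exact: step.
Qed.

End CoupledOscillators.

(** * Fourier coefficients of a bounded function *)

Section BoundedFourier.
Context {R : realType}.
Local Notation mu := (@lebesgue_measure R).

Lemma Lfun_infty_ae (f : R -> R) : f \in Lfun mu +oo%E ->
  measurable_fun [set: R] f /\ exists M, 0 <= M /\ {ae mu, forall x, `|f x| <= M}.
Proof.
move=> /andP[]; rewrite !inE => mf; rewrite /= /finite_norm unlock /Lnorm.
have muT : mu [set: R] = +oo%E.
  by rewrite -set_itvNyy; exact: (@lebesgue_measure_itv R `]-oo, +oo[).
case: ifPn => [_ fin|/negP[]]; last by rewrite [ltRHS]muT ltry.
split; first exact: mf.
exists (Num.max 0 (fine (ess_sup mu (abse \o (EFin \o f))))).
split; first by rewrite le_max lexx.
have := @ess_sup_ge _ _ _ mu (abse \o (EFin \o f)).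
apply: filterS => x /=.
case: (ess_sup _ _) fin => [r| |] //=; rewrite ?lee_fin => _ h.
by rewrite le_max h orbT.
Qed.

Lemma ae_bounded_Rintegral (f : R -> R) M (a b : R) : a <= b -> 0 <= M ->
    measurable_fun [set: R] f -> {ae mu, forall x, `|f x| <= M} ->
  `|\int[mu]_(x in `[a, b]) f x| <= M * (b - a).
Proof.
move=> ab M0 mf fM.
have /measurable_EFinP mf' : measurable_fun `[a, b] f by exact: measurable_funTS.
have intM : (\int[mu]_(x in `[a, b]) `|(EFin \o f) x| <= (M * (b - a))%:E)%E.
  apply: (@le_trans _ _ (\int[mu]_(x in `[a, b]) (cst M%:E) x)%E).
    apply: ae_ge0_le_integral => //=.
    - by apply/measurable_EFinP/measurableT_comp => //; exact: measurable_funTS.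
    - case: fM => N [mN N0 fN]; exists N; split=> // x /= nfx; apply: fN.
      by move=> /= fxM; apply: nfx; rewrite lee_fin.
  rewrite integral_cst//= lebesgue_measure_itv/= lte_fin.
  case: ifPn => _; first by rewrite EFinM EFinB.
  by rewrite mule0 lee_fin mulr_ge0// subr_ge0.
have := le_trans (le_abse_integral mu (measurable_itv _) mf') intM.
rewrite /Rintegral; case: (integral _ _ _) => [r| |] //=; rewrite ?lee_fin//.
Qed.

Lemma fourier_bounded (b : R -> R[i]) : Linfty_torus b ->
  exists M, 0 <= M /\ forall k, normc (fourier b k) <= M.
Proof.
move=> [_ /Lfun_infty_ae[mr [M1 [M10 bM1]]] /Lfun_infty_ae[mi [M2 [M20 bM2]]]].
exists (2 * (M1 + M2)); split=> [|k]; first by rewrite mulr_ge0// addr_ge0.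
have p0 : 0 < 2 * pi :> R by rewrite mulr_gt0// pi_gt0.
have M0 : 0 <= M1 + M2 by rewrite addr_ge0.
have comb (c d : R -> R) :
    measurable_fun [set: R] c -> measurable_fun [set: R] d ->
    (forall x, `|c x| <= 1) -> (forall x, `|d x| <= 1) ->
    `|\int[mu]_(x in `[0, 2 * pi]) (c x * complex.Re (b x) + d x * complex.Im (b x))|
      <= (M1 + M2) * (2 * pi).
  move=> mc md c1 d1; rewrite -[X in _ <= _ * X]subr0.
  apply: ae_bounded_Rintegral; rewrite ?(ltW p0)//.
    by apply: measurable_funD; apply: measurable_funM.
  apply: negligibleS (negligibleU bM1 bM2) => x /= nx.
  apply/not_andP => -[h1 h2]; apply: nx; apply: le_trans (ler_normD _ _) _.
  by apply: lerD; rewrite normrM -[leRHS]mul1r ler_pM.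
have mlin : measurable_fun [set: R] (fun x : R => - (k%:~R * x)).
  apply: continuous_measurable_fun => x.
  by apply: continuousN; apply: continuousM => //; exact: cst_continuous.
have mcos : measurable_fun [set: R] (fun x : R => cos (- (k%:~R * x))).
  by apply: measurableT_comp mlin; exact: continuous_measurable_fun (@continuous_cos R).
have msin : measurable_fun [set: R] (fun x : R => sin (- (k%:~R * x))).
  by apply: measurableT_comp mlin; exact: continuous_measurable_fun (@continuous_sin R).
have cos1 x : `|cos x| <= 1 :> R by rewrite ler_norml cos_geN1 cos_le1.
have sin1 x : `|sin x| <= 1 :> R by rewrite ler_norml sin_geN1 sin_le1.
rewrite /fourier normcZ gtr0_norm ?invr_gt0// ler_pdivrMl//.
apply: le_trans (normc_le_ReIm _) _; rewrite /cintegral /=.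
have -> : 2 * pi * (2 * (M1 + M2)) =
  (M1 + M2) * (2 * pi) + (M1 + M2) * (2 * pi) by ring.
apply: lerD.
- rewrite (_ : (fun x => _) = (fun x => cos (- (k%:~R * x)) * complex.Re (b x) +
    - sin (- (k%:~R * x)) * complex.Im (b x))).
    by apply: comb => // [|x]; [exact: measurableT_comp msin|rewrite normrN].
  by apply/funext => x; case: (b x) => p q /=; rewrite mulNr.
- rewrite (_ : (fun x => _) = (fun x => sin (- (k%:~R * x)) * complex.Re (b x) +
    cos (- (k%:~R * x)) * complex.Im (b x))); first exact: comb.
  by apply/funext => x; case: (b x) => p q /=; rewrite addrC.
Qed.

End BoundedFourier.

(** * The coefficients of the water wave system *)

Section WaterWaveCoefficients.
Context {R : realType}.
Implicit Types (mu x y : R).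

Lemma sech_ge0 x : 0 <= sech x.
Proof. by rewrite divr_ge0// addr_ge0 ?expR_ge0. Qed.

Lemma sech_le x : sech x <= 2 * expR (- x).
Proof.
rewrite expRN ler_wpM2l// lef_pV2 ?posrE ?addr_gt0 ?expR_gt0//.
by rewrite lerDl expR_ge0.
Qed.

Lemma tanh_le1 x : tanh x <= 1.
Proof.
rewrite ler_pdivrMr ?addr_gt0 ?expR_gt0// mul1r.
by have := expR_ge0 (- x); lra.
Qed.

Lemma tanh_gt0 x : 0 < x -> 0 < tanh x.
Proof.
move=> x0; apply: divr_gt0; last by rewrite addr_gt0 ?expR_gt0.
by rewrite subr_gt0 ltr_expR; lra.
Qed.

Lemma tanh_le x y : x <= y -> tanh x <= tanh y.
Proof.
move=> xy; rewrite /tanh ler_pdivrMr ?addr_gt0 ?expR_gt0// mulrAC.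
rewrite ler_pdivlMr ?addr_gt0 ?expR_gt0//.
have h1 : expR x <= expR y by rewrite ler_expR.
have h2 : expR (- y) <= expR (- x) by rewrite ler_expR lerN2.
have := expR_gt0 x; have := expR_gt0 (- y); nra.
Qed.

Lemma Omega_ge0 mu k : 0 <= Omega mu k.
Proof. exact: sqrtr_ge0. Qed.

Lemma Omega_le mu k : 0 < mu ->
  Omega mu k <= Num.sqrt (Num.sqrt mu)^-1 * Num.sqrt (1 + `|k%:~R|).
Proof.
move=> mu0; have m0 : 0 < (Num.sqrt mu)^-1 by rewrite invr_gt0 sqrtr_gt0.
rewrite -sqrtrM ?(ltW m0)// ler_wsqrtr// -mulrA ler_wpM2l ?(ltW m0)//.
apply: le_trans (_ : `|k%:~R| * 1 <= _); last by rewrite mulr1 lerDr.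
by rewrite ler_wpM2l// tanh_le1.
Qed.

(** As [tanh] increases, the modes [k = 1] and [k = - 1] are the slowest ones
    besides the zero mode. *)
Lemma Omega_gt0 mu : 0 < mu ->
  exists2 c, 0 < c & forall k, k != 0 -> c <= Omega mu k.
Proof.
move=> mu0; have m0 : 0 < Num.sqrt mu by rewrite sqrtr_gt0.
have th0 := tanh_gt0 m0.
exists (Num.sqrt ((Num.sqrt mu)^-1 * tanh (Num.sqrt mu))).
  by rewrite sqrtr_gt0 mulr_gt0 ?invr_gt0.
move=> k k0; have k1 : 1 <= `|k%:~R| :> R.
  by rewrite -intr_norm -[1]/(1%:~R) ler_int -gtz0_ge1 normr_gt0.
rewrite ler_wsqrtr// -mulrA ler_wpM2l ?invr_ge0 ?(ltW m0)//.
rewrite -[leLHS]mul1r ler_pM//; first exact: ltW.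
by apply: tanh_le; rewrite ler_peMr// ltW.
Qed.

(** The matrix of the coupling is at most [profile n * profile m] if [M] bounds
    the Fourier coefficients; each factor gets one half of this bound. *)
Definition profile mu (M : R) k : R :=
  Num.sqrt M * (G mu k * Omega mu k `^ (- 2^-1)) * `|k%:~R|.

Lemma profile_ge0 mu M k : 0 <= profile mu M k.
Proof.
by rewrite !mulr_ge0 ?sqrtr_ge0 ?powR_ge0// /G sech_ge0.
Qed.

Lemma normc_bilinear (p q : R) (n m : int) (z : R[i]) : 0 <= p -> 0 <= q ->
  normc (p%:C * ('i * n%:~R) * z * ('i * m%:~R) * q%:C) =
  p * `|n%:~R| * normc z * `|m%:~R| * q.
Proof.
move=> p0 q0.
have i1 : normc ('i : R[i]) = 1.
  by have := normCi R[i]; rewrite normc_def => /(congr1 (@complex.Re R)).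
have iZ k : normc ('i * k%:~R : R[i]) = `|k%:~R|.
  by rewrite Normc.normcM i1 mul1r normc_int.
by rewrite 4!Normc.normcM !iZ !normcR (ger0_norm p0) (ger0_norm q0).
Qed.

Lemma A_le_profile mu (b : R -> R[i]) M n m : 0 <= M ->
    (forall k, normc (fourier b k) <= M) ->
  normc (A mu b n m) <= profile mu M n * profile mu M m.
Proof.
move=> M0 bM; have g0 k : 0 <= G mu k * Omega mu k `^ (- 2^-1).
  by rewrite mulr_ge0 ?powR_ge0// /G sech_ge0.
rewrite /A normc_bilinear ?g0// /profile.
move: (g0 n) (g0 m) (bM (n - m)); move: (G mu n * _) (G mu m * _) (fourier b _).
move=> p q z p0 q0 zM.
have -> : Num.sqrt M * p * `|n%:~R| * (Num.sqrt M * q * `|m%:~R|) =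
    p * `|n%:~R| * `|m%:~R| * q * Num.sqrt M ^+ 2 by ring.
rewrite sqr_sqrtr//.
have -> : p * `|n%:~R| * normc z * `|m%:~R| * q =
    p * `|n%:~R| * `|m%:~R| * q * normc z by ring.
by rewrite ler_wpM2l// !mulr_ge0.
Qed.

(** The hyperbolic secant decays like [exp (- c |k|)], which beats the
    polynomial weights and the frequencies, of order [sqrt |k|]. *)
Lemma profile_decay mu M s sigma : 0 < mu -> 0 <= s -> exists C, forall k,
  weight s k * profile mu M k * expR (sigma * Omega mu k) <= C * invsq k.
Proof.
move=> mu0 s0; set m := Num.sqrt mu; have m0 : 0 < m by rewrite sqrtr_gt0.
have [c c0 Oc] := Omega_gt0 mu0.
pose c2 := c `^ (- 2^-1); pose c3 := Num.sqrt m^-1.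
pose be := 2 * s + 6 + `|sigma| * c3.
pose C := 2 * Num.sqrt M * c2 * expR (be ^+ 2 / (4 * m) + m).
have M0 : 0 <= Num.sqrt M by exact: sqrtr_ge0.
have c20 : 0 <= c2 by exact: powR_ge0.
exists C => k; rewrite /invsq ler_pdivlMr; last by rewrite exprn_gt0// ltr_wpDr.
pose ka : R := `|k%:~R|; have ka0 : 0 <= ka by exact: normr_ge0.
pose rho := Num.sqrt (1 + ka).
have rho2 : rho ^+ 2 = 1 + ka by rewrite sqr_sqrtr// addr_ge0.
have rho0 : 0 <= rho by exact: sqrtr_ge0.
have rho1 : 1 <= rho by rewrite -sqrtr1 ler_wsqrtr// lerDl.
have rhoe : rho <= expR rho by have := expR_ge1Dx rho; lra.
have e2 : 1 + ka <= expR (2 * rho).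
  by rewrite -rho2 (expRM_natl 2) lerXn2r ?nnegrE ?expR_ge0.
have w_le : weight s k <= expR (2 * s * rho).
  rewrite /weight -/ka /powR gt_eqF ?ltr_wpDr// ler_expR.
  rewrite [2 * s]mulrC -mulrA ler_wpM2l//.
  by rewrite -ler_expR lnK// posrE ltr_wpDr.
have a_le : profile mu M k <=
    2 * Num.sqrt M * c2 * (expR (2 * rho) * expR (- (m * ka))).
  rewrite /profile -/ka; have [k0|k0] := eqVneq k 0.
    by rewrite /ka k0 mulr0z normr0 mulr0 mulr_ge0 ?mulr_ge0 ?expR_ge0.
  have O2 : Omega mu k `^ (- 2^-1) <= c2.
    rewrite /c2 !powRN lef_pV2 ?posrE ?powR_gt0 ?(lt_le_trans c0 (Oc k k0))//.
    by rewrite ge0_ler_powR ?nnegrE ?invr_ge0 ?(ltW c0) ?Omega_ge0// Oc.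
  have g2 : G mu k <= 2 * expR (- (m * ka)) by exact: sech_le.
  have h := ler_pM (sech_ge0 _) (powR_ge0 _ _) g2 O2.
  have ka_le : ka <= expR (2 * rho) by apply: le_trans e2; rewrite lerDr.
  have -> : 2 * Num.sqrt M * c2 * (expR (2 * rho) * expR (- (m * ka))) =
    Num.sqrt M * (2 * expR (- (m * ka)) * c2) * expR (2 * rho) by ring.
  apply: ler_pM => //; last exact: ler_wpM2l.
  by rewrite mulr_ge0// mulr_ge0 ?powR_ge0 ?sech_ge0.
have O_le : expR (sigma * Omega mu k) <= expR (`|sigma| * c3 * rho).
  rewrite ler_expR -mulrA; apply: le_trans (_ : `|sigma| * Omega mu k <= _).
    by rewrite ler_wpM2r ?Omega_ge0// ler_norm.
  by rewrite ler_wpM2l// Omega_le.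
have q_le : (1 + ka) ^+ 2 <= expR (4 * rho).
  have -> : 4 * rho = 2%:R * (2 * rho) by ring.
  by rewrite (expRM_natl 2) lerXn2r ?nnegrE ?expR_ge0 ?addr_ge0.
have w0 := ltW (weight_gt0 s k).
have h1 := ler_pM w0 (profile_ge0 mu M k) w_le a_le.
have h2 := ler_pM (mulr_ge0 w0 (profile_ge0 mu M k)) (expR_ge0 _) h1 O_le.
have h3 := ler_pM (mulr_ge0 (mulr_ge0 w0 (profile_ge0 mu M k)) (expR_ge0 _))
  (sqr_ge0 (1 + ka)) h2 q_le.
apply: le_trans h3 _.
have -> : expR (2 * s * rho) *
    (2 * Num.sqrt M * c2 * (expR (2 * rho) * expR (- (m * ka)))) *
    expR (`|sigma| * c3 * rho) * expR (4 * rho) =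
  2 * Num.sqrt M * c2 * expR (be * rho - m * ka).
  have -> : be * rho - m * ka = 2 * s * rho + (2 * rho + - (m * ka)) +
      `|sigma| * c3 * rho + 4 * rho by rewrite /be; ring.
  by rewrite !expRD; ring.
rewrite /C ler_wpM2l ?mulr_ge0// ler_expR.
(* Completing the square in [rho]. *)
have -> : be * rho - m * ka =
    be ^+ 2 / (4 * m) + m - m * (rho - be / (2 * m)) ^+ 2.
  have -> : ka = rho ^+ 2 - 1 by rewrite rho2; ring.
  by field; rewrite gt_eqF.
by rewrite lerBlDr lerDl mulr_ge0 ?sqr_ge0// ltW.
Qed.

End WaterWaveCoefficients.

Theorem theorem4p8 (R : realType) (mu : R) (b : R -> R[i])
    (mu_gt0 : 0 < mu) (b_Linfty : Linfty_torus b) (s : R) (s_ge0 : 0 <= s) :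
  exists C tau0 : R,
    [/\ 0 < C, 0 < tau0 &
     forall (x : state R) (tau : R), hs s x -> `|tau| <= tau0 ->
       (norm_hs s (flow s (S1 mu) tau (flow s (S2 mu b) tau x)
                   - flow s (S1 mu \+ S2 mu b) tau x)%R
          <= (C * tau ^+ 2)%:E * norm_hs s x)%E
       /\
       (norm_hs s (flow s (S1 mu) (tau / 2)
                     (flow s (S2 mu b) tau (flow s (S1 mu) (tau / 2) x))
                   - flow s (S1 mu \+ S2 mu b) tau x)%R
          <= (C * `|tau| ^+ 3)%:E * norm_hs s x)%E].
Proof.
have [M [M0 bM]] := fourier_bounded b_Linfty.
exact: (splitting_error s_ge0 (@Omega_ge0 R mu) (@profile_ge0 R mu M)
  (fun n m => A_le_profile mu n m M0 bM)
  (fun sigma => profile_decay M sigma mu_gt0 s_ge0)).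
Qed.
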